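(* The problem SATISFACTION for non-oblivious models corresponding to star influence games is solvable in polynomial time. That is, there is a polynomial time algorithm that, given a star influence game $\Gamma=(G,f,q,N)$ and an actor $i\in V(G)$, computes $\mathrm{Sat}_{\mathcal{M}^n(\Gamma)}(i)$.
   Context: Graphs are finite, directed, without loops or multiple edges; $P_G(i)=P(i)=\{j\mid (j,i)\in E\}$. An influence graph is a pair $(G,f)$ with $G=(V,E)$ a digraph and $f$ assigning to each vertex a non-negative rational. For $X\subseteq V$, $n=|V|$: $F^0(X)=X$, $F^t(X)=F^{t-1}(X)\cup\{i\in V\mid |P_G(i)\cap F^{t-1}(X)|\ge f(i)\}$ for $1\le t\le n$, and $F(X)=F^n(X)$. An influence game is $\Gamma=(G,f,q,N)$ with $(G,f)$ an influence graph, $q$ an integer, $0\le q\le n$, and $N\subseteq V$. A star influence graph is an influence graph $(G,f)$ where $V(G)=\mathtt{L}\cup\mathtt{I}\cup\mathtt{R}\cup\{c\}\cup\mathtt{F}$ (pairwise disjoint sets; $c$ is the central vertex) and $E(G)=\{(u,c)\mid u\in\mathtt{L}\cup\mathtt{R}\}\cup\{(c,v)\mid v\in\mathtt{R}\cup\mathtt{F}\}$. A star influence game is an influence game $(G,f,q,N)$ where $(G,f)$ is a star influence graph and $N=\mathtt{L}\cup\mathtt{R}\cup\mathtt{I}$. The non-oblivious influence model $\mathcal{M}^n(\Gamma)$ (for $f$ positive, i.e. $f(i)>0$ for all $i$) is defined as follows. For $x\in\{0,1\}^n$ let $X(x)=\{i\mid x_i=1\}$, $p_i(x)=|F(X(x)\cap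 N)\cap P(i)|$, $q_i(x)=|P(i)\setminus F(X(x)\cap N)|$. For $i\in V\setminus N$: $c_i=1$ if $p_i(x)\ge f(i)$ and $q_i(x)<f(i)$; $c_i=0$ if $q_i(x)\ge f(i)$ and $p_i(x)<f(i)$; $c_i=x_i$ otherwise. For $i\in N$: $c_i=1$ if $i\in F(X(x))$, else $c_i=0$. The collective decision function is $C(x)=1$ if $|\{i\in V\mid c_i=1\}|\ge q$ and $C(x)=0$ otherwise. The satisfaction of actor $i$ is $\mathrm{Sat}(i)=|\{x\in\{0,1\}^n\mid C(x)=x_i\}|$. *)

(* Defs.v *)
From mathcomp Require Import all_boot all_order all_algebra.

Set Implicit Arguments.
Unset Strict Implicit.
Unset Printing Implicit Defensive.

Import Order.TTheory GRing.Theory Num.Theory.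

Record influence_graph (V : finType) := InfluenceGraph {
  edge : rel V;
  edge_irreflexive : irreflexive edge;
  label : V -> rat;
  label_ge0 : forall i, (0 <= label i)%R }.

Record influence_game (V : finType) := InfluenceGame {
  graph :> influence_graph V;
  quota : nat;
  quota_le : quota <= #|V|;
  team : {set V} }.

Section Spread.
Variables (V : finType) (G : influence_graph V).

Definition preds (i : V) : {set V} := [set j | edge G j i].

Definition spread_step (X : {set V}) : {set V} :=
  X :|: [set i | (label G i <= #|preds i :&: X|%:R)%R].

Definition spread (X : {set V}) : {set V} := iter #|V| spread_step X.

Definition positive_labels : Prop := forall i, (0 < label G i)%R.

Definition star_graph (L I R : {set V}) (c : V) (F : {set V}) : Prop :=
  [/\ L :|: I :|: R :|: [set c] :|: F = [set: V],
      pairwise (fun A B : {set V} => [disjoint A & B])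
        [:: L; I; R; [set c]; F]
    & forall u v, edge G u v = (u \in L :|: R) && (v == c)
                            || (u == c) && (v \in R :|: F)].

End Spread.

Definition star_game (V : finType) (g : influence_game V) : Prop :=
  exists (L I R : {set V}) (c : V) (F : {set V}),
    star_graph g L I R c F /\ team g = L :|: R :|: I.

Section NonOblivious.
Variables (V : finType) (g : influence_game V).
Implicit Types (x : {ffun V -> bool}) (i : V).

Definition support_of x : {set V} := [set i | x i].

Definition active_preds x i : nat :=
  #|spread g (support_of x :&: team g) :&: preds g i|.

Definition inactive_preds x i : nat :=
  #|preds g i :\: spread g (support_of x :&: team g)|.

Definition final_decision x i : bool :=
  let p : rat := (active_preds x i)%:R%R in
  let q : rat := (inactive_preds x i)%:R%R in
  let f := label g i in
  if i \in team g then i \in spread g (support_of x)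
  else if ((f <= p) && (q < f))%R then true
  else if ((f <= q) && (p < f))%R then false
  else x i.

Definition collective_decision x : bool :=
  quota g <= #|[set i | final_decision x i]|.

Definition Sat i : nat :=
  #|[set x : {ffun V -> bool} | collective_decision x == x i]|.

End NonOblivious.

(* Time is measured on the random access machine of Cook and Reckhow, under
   the logarithmic cost criterion, which is polynomially related to Turing
   machine time.  Registers hold naturals, so subtraction is truncated. *)

Inductive instr :=
| IConst of nat & nat
| IAdd of nat & nat & nat
| ISub of nat & nat & nat
| ILoad of nat & nat
| IStore of nat & nat
| IJump of nat & nat
| IRead of nat.

Definition program := seq instr.

Record config := Config {
  pc : nat;
  regs : nat -> nat;
  tape : seq nat }.

(* Number of binary digits, with bitlen 0 = 1. *)
Definition bitlen (k : nat) : nat := (trunc_log 2 k).+1.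

Definition set_reg (r : nat -> nat) (i v : nat) : nat -> nat :=
  fun j => if j == i then v else r j.

(* Reading past the end of the input yields 0. *)
Definition next (a : instr) (s : config) : config :=
  let: Config m r w := s in
  match a with
  | IConst i k => Config m.+1 (set_reg r i k) w
  | IAdd i j k => Config m.+1 (set_reg r i (r j + r k)) w
  | ISub i j k => Config m.+1 (set_reg r i (r j - r k)) w
  | ILoad i j => Config m.+1 (set_reg r i (r (r j))) w
  | IStore i j => Config m.+1 (set_reg r (r i) (r j)) w
  | IJump i l => Config (if 0 < r i then l else m.+1) r w
  | IRead i => Config m.+1 (set_reg r i (head 0 w)) (behead w)
  end.

Definition cost (a : instr) (s : config) : nat :=
  let r := regs s in
  match a with
  | IConst _ k => bitlen k
  | IAdd _ j k | ISub _ j k => bitlen (r j) + bitlen (r k)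
  | ILoad _ j => bitlen (r j) + bitlen (r (r j))
  | IStore i j => bitlen (r i) + bitlen (r j)
  | IJump i _ => bitlen (r i)
  | IRead _ => bitlen (head 0 (tape s))
  end.

(* runs P s t s': from s, program P halts in s' (by leaving the program text)
   after a computation of total cost t. *)
Inductive runs (P : program) : config -> nat -> config -> Prop :=
| runs_halt s : onth P (pc s) = None -> runs P s 0 s
| runs_step s a t s' : onth P (pc s) = Some a ->
    runs P (next a s) t s' -> runs P s (cost a s + t) s'.

Definition computes_in (P : program) (w : seq nat) (v t : nat) : Prop :=
  exists2 s, runs P (Config 0 (fun=> 0) w) t s & regs s 0 = v.

Definition input_size (w : seq nat) : nat := \sum_(k <- w) bitlen k.

(* The machine only has to be correct and fast on encodings of the instances
   satisfying the promise. *)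
Definition polytime_solvable (T : Type) (promise : T -> Prop)
    (encode : T -> seq nat) (answer : T -> nat) : Prop :=
  exists (P : program) (c d : nat), forall z, promise z ->
    exists2 t, computes_in P (encode z) (answer z) t
             & t <= c * input_size (encode z) ^ d + c.

(* Vertices are numbered 0, ..., n - 1. *)
Record sat_instance := SatInstance {
  nb_actors : nat;
  game : influence_game 'I_nb_actors;
  actor : 'I_nb_actors }.

(* n, q, the actor, the adjacency matrix by rows, the characteristic vector of
   the team, then the numerator and denominator of each label in lowest terms
   (both are nonnegative, so no information is lost by taking `|_|). *)
Definition encode_instance (z : sat_instance) : seq nat :=
  let g := game z in
  let V := enum 'I_(nb_actors z) in
  [:: nb_actors z; quota g; nat_of_ord (actor z)]
  ++ [seq nat_of_bool (edge g u v) | u <- V, v <- V]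
  ++ [seq nat_of_bool (u \in team g) | u <- V]
  ++ flatten [seq [:: `|numq (label g u)|%N; `|denq (label g u)|%N] | u <- V].

Definition star_instance (z : sat_instance) : Prop :=
  star_game (game z) /\ positive_labels (game z).

Definition Sat_of (z : sat_instance) : nat := Sat (game z) (actor z).

(* Main.v *)
(* Proof idea.  A vote of the team spreads only through the center, so the
   collective decision depends on five numbers: how many vertices vote yes among
   the predecessors of the center which do not follow it, among those which do
   follow it, and among the vertices whose decision is always their own vote;
   the vote of the center; and, for the satisfaction, the vote of the actor.
   Give every vertex a weight such that the weight of a vote is the number whose
   digits in base n are these five numbers.  Then Sat is a sum, over polynomially
   many keys, of the number of votes of weight equal to the key, and these
   numbers are the coefficients of the product of the 1 + X^w over all weights w,
   computed by the subset sum dynamic program.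
   The dynamic program is written in a language whose loops all run n times, and
   is compiled to the random access machine.  A number at most doubles at each
   instruction, so polynomially many instructions have polynomial total cost. *)

From mathcomp Require Import all_boot all_order all_algebra zify.
Require Import Defs.

Set Implicit Arguments.
Unset Strict Implicit.
Unset Printing Implicit Defensive.

Import Order.TTheory GRing.Theory Num.Theory.

(** * Running time of the machine *)

(** Spreading is over after two rounds. Positive labels keep out every vertex without an active
    predecessor, so [L] and [I] never gain members; a vertex of [R] or [F] has the center as its
    only predecessor and follows it exactly when its label is at most 1. This bound cuts across [R]
    and [F]: the classes that matter are not the parts of the star. The parts are not in the input
    either. The classes are recovered from team membership, the existence of an outgoing and of an
    incoming edge, and the comparison of the label with 1. The center is counted in none of the
    first three numbers, so each is at most n - 1 and base n digits do not carry. The two single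
    votes are bits above them, which gives 4 n^3 keys. The vote of the actor needs a bit of its own
    since the actor may already count in another digit. The label of the center may be any positive
    rational, but it is compared only with counts below n, so a ceiling cut off at n replaces it.
    The table entries may grow exponentially in n, but only their bit lengths are charged. *)

Inductive reach (P : program) : nat -> config -> config -> Prop :=
| reach_refl s : reach P 0 s s
| reach_next s a t s' : onth P (pc s) = Some a ->
    reach P t (next a s) s' -> reach P t.+1 s s'.

Lemma reach_trans P t1 t2 s1 s2 s3 :
  reach P t1 s1 s2 -> reach P t2 s2 s3 -> reach P (t1 + t2) s1 s3.
Proof.
elim=> {s1 s2 t1} [//|s a t s' Pa _ IH] /IH; rewrite addSn.
exact: reach_next Pa.
Qed.

Lemma bitlen_le b k : 0 < b -> k < 2 ^ b -> bitlen k <= b.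
Proof.
case: k => [|k] b_gt0 lt_kb; first by rewrite /bitlen trunc_log0.
rewrite /bitlen -(ltn_exp2l _ _ (isT : 1 < 2)).
by apply: leq_ltn_trans lt_kb; apply: trunc_logP.
Qed.

Lemma ltn_bitlen k : k < 2 ^ bitlen k.
Proof. exact: trunc_log_ltn. Qed.

Definition small (b : nat) (s : config) : Prop :=
  (forall i, regs s i < 2 ^ b) /\ all (fun k => k < 2 ^ b) (tape s).

Definition small_const (b : nat) (a : instr) : bool :=
  if a is IConst _ k then k < 2 ^ b else true.

Lemma small_head b s : small b s -> head 0 (tape s) < 2 ^ b.
Proof. by case: s => m r [|k w] [_ /=]; [rewrite expn_gt0 | case/andP]. Qed.

Lemma small_next b a s : small_const b a -> small b s -> small b.+1 (next a s).
Proof.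
case: s => m r w sa ss; have lt_head := small_head ss.
have [/= lt_r lt_w] := ss.
have lt2 k : k < 2 ^ b -> k < 2 ^ b.+1 by rewrite expnS; lia.
have lt_w' v : all (fun k => k < 2 ^ b) v -> all (fun k => k < 2 ^ b.+1) v.
  by apply: sub_all => k; apply: lt2.
have lt_set i v : v < 2 ^ b.+1 -> forall j, set_reg r i v j < 2 ^ b.+1.
  by move=> lt_v j; rewrite /set_reg; case: eqP => // _; apply: lt2.
case: a sa => [i k|i j k|i j k|i j|i j|i l|i] //= sa; split=> //=;
  try (exact: lt_w' lt_w); try (by move=> ?; apply: lt2); try apply: lt_set.
- exact: lt2.
- by rewrite expnS; have := lt_r j; have := lt_r k; lia.
- by apply: lt2; apply: leq_ltn_trans (leq_subr _ _) (lt_r j).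
- exact: lt2.
- exact: lt2.
- exact: lt2.
- by apply: lt_w'; case: (w) lt_w => //= ? ? /andP[].
Qed.

Lemma cost_small b a s : 0 < b -> small_const b a -> small b s ->
  cost a s <= 2 * b.
Proof.
move=> b_gt0 sa ss; have lt_head := small_head ss.
have [lt_r _] := ss; have le_r i := bitlen_le b_gt0 (lt_r i).
have [le1 le2] : b <= 2 * b /\ b + b <= 2 * b by lia.
case: a sa => [i k|i j k|i j k|i j|i j|i l|i] /= sa;
  try exact: leq_trans (leq_add _ _) le2;
  apply: leq_trans le1 => //; exact: bitlen_le.
Qed.

(* Each instruction at most doubles the largest number in the machine, so
   [t] instructions on [b]-bit data handle numbers of at most [b + t] bits. *)
Lemma reach_runs P b t s s' : 0 < b -> all (small_const b) P -> small b s ->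
  reach P t s s' -> onth P (pc s') = None ->
  exists2 t', runs P s t' s' & t' <= t * (2 * (b + t)).
Proof.
move=> + + + Hst; elim: Hst b => {s s' t} [s|s a t s' Pa _ IH] b b_gt0 sP ss Ps'.
  by exists 0; [apply: runs_halt|].
have sa : small_const b a.
  by elim: (P) (pc s) Pa sP => [|a' P' IHP] [|k] //= => [[->] | /IHP IH'] /andP[//].
have sP' : all (small_const b.+1) P.
  by apply: sub_all sP => -[] //= _ k; rewrite expnS; lia.
(* The numbers gain one bit while one instruction fewer remains, so [b + t] is the same for the rest
   of the run. *)
have [t' run_t' le_t'] := IH b.+1 isT sP' (small_next sa ss) Ps'.
exists (cost a s + t'); first exact: runs_step Pa run_t'.
apply: leq_trans (leq_add (cost_small b_gt0 sa ss) le_t') _.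
by rewrite addSnnS mulSn leq_add2r; lia.
Qed.

Lemma small_const_exists P : exists b, all (small_const b) P.
Proof.
elim: P => [|a P [b sP]]; first by exists 0.
have [k sa] : exists k, small_const k a.
  by case: a => [i k|||||| ] *; try (by exists 0); exists k; apply: ltn_expl.
exists (k + b) => /=; apply/andP; split.
  case: a sa => //= _ j; rewrite expnD.
  by have := expn_gt0 2 b; nia.
apply: sub_all sP => -[] //= _ j; rewrite expnD.
by have := expn_gt0 2 k; nia.
Qed.

(** * A structured language and its compiler *)

Inductive expr :=
| Cst of nat
| Size
| Get of nat & expr
| Add of expr & expr
| Sub of expr & expr.

(* [Unless e c] runs [c] when [e] is zero.  [Loop c] runs [c] as often as the
   fixed number which is the first input, so that the running time of every
   command is a polynomial in that number. *)
Inductive cmd :=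
| Put of nat & expr & expr
| Read of nat & expr
| Unless of expr & cmd
| Seq of cmd & cmd
| Loop of cmd.

Definition memory := nat -> nat -> nat.

Definition upd (m : memory) (a i v : nat) : memory :=
  fun a' i' => if (a' == a) && (i' == i) then v else m a' i'.

Record state := State { mem : memory; inp : seq nat }.

Fixpoint value (N : nat) (m : memory) (e : expr) : nat :=
  match e with
  | Cst k => k
  | Size => N
  | Get a e => m a (value N m e)
  | Add e1 e2 => value N m e1 + value N m e2
  | Sub e1 e2 => value N m e1 - value N m e2
  end.

Fixpoint eval (N : nat) (c : cmd) (s : state) : state :=
  match c with
  | Put a e1 e2 =>
      State (upd (mem s) a (value N (mem s) e1) (value N (mem s) e2)) (inp s)
  | Read a e =>
      State (upd (mem s) a (value N (mem s) e) (head 0 (inp s))) (behead (inp s))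
  | Unless e c => if value N (mem s) e == 0 then eval N c s else s
  | Seq c1 c2 => eval N c2 (eval N c1 s)
  | Loop c => iter N (eval N c) s
  end.

(* Register 0 holds the number of iterations; the other registers are split
   into infinitely many infinite rows by their 2-adic valuation: row 0 for
   temporaries, row 1 for loop counters, row a + 2 for row a of the memory. *)
Definition cell (a i : nat) : nat := 2 ^ a * i.*2.+1.

Definition tmp := cell 0.
Definition cnt := cell 1.

Lemma cell_gt0 a i : 0 < cell a i.
Proof. by rewrite muln_gt0 expn_gt0. Qed.

Lemma tmp_eq0 d : (0 == tmp d) = false.
Proof. by apply/eqP => E; have := cell_gt0 0 d; rewrite -[cell 0 d]E. Qed.

Lemma cell_inj a i a' i' : cell a i = cell a' i' -> a = a' /\ i = i'.
Proof.
rewrite /cell; elim: a a' => [|a IHa] [|a'] /=.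
- by rewrite !mul1n; lia.
- by rewrite expnS -mulnA; move: (2 ^ a' * _) => u; lia.
- by rewrite expnS -mulnA; move: (2 ^ a * _) => u; lia.
- by rewrite !expnS -!mulnA => E; have [|-> //] := IHa a'; lia.
Qed.

(* Turns the index [i] in the temporary [d] into the register number
   [cell a i]. *)
Definition caddr (a d : nat) : program :=
  [:: IAdd (tmp d) (tmp d) (tmp d), IConst (tmp d.+1) 1,
      IAdd (tmp d) (tmp d) (tmp d.+1) & nseq a (IAdd (tmp d) (tmp d) (tmp d))].

Arguments cell : simpl never.

(** The temporaries form a stack: the value ends up in [tmp d], and only temporaries from [d] on are
    overwritten. The machine has no move instruction, so register 0 is copied by adding it to
    zero. *)
Fixpoint cexpr (e : expr) (d : nat) : program :=
  match e with
  | Cst k => [:: IConst (tmp d) k]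
  | Size => [:: IConst (tmp d) 0; IAdd (tmp d) (tmp d) 0]
  | Get a e => cexpr e d ++ caddr a.+2 d ++ [:: ILoad (tmp d) (tmp d)]
  | Add e1 e2 =>
      cexpr e1 d ++ cexpr e2 d.+1 ++ [:: IAdd (tmp d) (tmp d) (tmp d.+1)]
  | Sub e1 e2 =>
      cexpr e1 d ++ cexpr e2 d.+1 ++ [:: ISub (tmp d) (tmp d) (tmp d.+1)]
  end.

(* [d] is the number of enclosing loops and [o] the address of the code. *)
Fixpoint ccmd (c : cmd) (d o : nat) : program :=
  match c with
  | Put a e1 e2 =>
      (cexpr e1 0 ++ caddr a.+2 0) ++ (cexpr e2 1 ++ [:: IStore (tmp 0) (tmp 1)])
  | Read a e =>
      (cexpr e 0 ++ caddr a.+2 0) ++ [:: IRead (tmp 1); IStore (tmp 0) (tmp 1)]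
  | Unless e c =>
      let test := cexpr e 0 in
      let body := ccmd c d (o + size test).+1 in
      test ++ IJump (tmp 0) ((o + size test).+1 + size body) :: body
  | Seq c1 c2 =>
      let code := ccmd c1 d o in code ++ ccmd c2 d (o + size code)
  | Loop c =>
      [:: IConst (cnt d) 0; IAdd (cnt d) (cnt d) 0]
      ++ ccmd c d.+1 o.+2
      ++ [:: IConst (tmp 0) 1; ISub (cnt d) (cnt d) (tmp 0);
             IJump (cnt d) o.+2]
  end.

(** * Correctness of compiled expressions *)

Definition is_jump (a : instr) : bool := if a is IJump _ _ then true else false.

Definition straight (code : program) (s : config) : config :=
  foldl (fun s a => next a s) s code.

Lemma straight_cat c1 c2 s : straight (c1 ++ c2) s = straight c2 (straight c1 s).
Proof. exact: foldl_cat. Qed.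

Lemma onth_size_cat (T : Type) (pre post : seq T) (a : T) :
  onth (pre ++ a :: post) (size pre) = Some a.
Proof. by elim: pre. Qed.

Lemma reach_straight pre code post r w : ~~ has is_jump code ->
  reach (pre ++ code ++ post) (size code) (Config (size pre) r w)
        (straight code (Config (size pre) r w)).
Proof.
elim: code pre r w => [|a code IH] pre r w; first by move=> _; apply: reach_refl.
rewrite /= negb_or => /andP[Na Ncode].
apply: (@reach_next _ _ a); first exact: onth_size_cat.
move: Na (fun r w => IH (rcons pre a) r w Ncode); rewrite size_rcons cat_rcons.
by case: a => //= *; auto.
Qed.

Lemma nojump_caddr a d : ~~ has is_jump (caddr a d).
Proof. by rewrite /caddr /=; elim: a. Qed.

Definition same_but_tmp (d : nat) (r r' : nat -> nat) : Prop :=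
  forall j, (forall d', d <= d' -> j <> tmp d') -> r' j = r j.

Lemma same_but_tmp_trans d d' r r' r'' : d <= d' ->
  same_but_tmp d r r' -> same_but_tmp d' r' r'' -> same_but_tmp d r r''.
Proof.
move=> le_d rr' r'r'' j Nj; rewrite -rr' // r'r'' // => d'' le_d''.
by apply: Nj; apply: leq_trans le_d''.
Qed.

Lemma same_but_tmp_set d d' v r r' : d <= d' ->
  same_but_tmp d r r' -> same_but_tmp d r (set_reg r' (tmp d') v).
Proof.
move=> le_d rr' j Nj; rewrite -(rr' j Nj) /set_reg.
by have /eqP/negPf-> := Nj _ le_d.
Qed.

Lemma straight_caddr a d p r w : exists r',
  [/\ straight (caddr a d) (Config p r w) = Config (p + size (caddr a d)) r' w,
      r' (tmp d) = cell a (r (tmp d)) & same_but_tmp d r r'].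
Proof.
have tmpS : (tmp d == tmp d.+1) = false.
  by apply/eqP => /cell_inj[_]; lia.
suff [r' [E1 E2 E3]] : exists r',
  [/\ straight (caddr a d) (Config p r w) = Config (3 + a + p) r' w,
      r' (tmp d) = cell a (r (tmp d)) & same_but_tmp d r r'].
  by exists r'; split=> //; rewrite E1 /= size_nseq; congr Config; lia.
rewrite /straight /caddr /= -/(straight _ _); elim: a => [|a [r' [E1 E2 E3]]].
  rewrite /=; eexists; split; first by reflexivity.
    by rewrite /set_reg !eqxx tmpS /= /cell; lia.
  move=> j Nj; rewrite /set_reg.
  have /eqP/negPf-> := Nj _ (leqnn d).
  by have /eqP/negPf-> := Nj _ (leqnSn d).
rewrite -[a.+1]addn1 nseqD straight_cat E1 /=.
eexists; split; first by congr Config; lia.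
  by rewrite /set_reg eqxx E2 /cell addn1 expnS; lia.
move=> j Nj; rewrite -(E3 j Nj) /set_reg.
by have /eqP/negPf-> := Nj _ (leqnn d).
Qed.

Opaque caddr.

Lemma nojump_cexpr e d : ~~ has is_jump (cexpr e d).
Proof.
elim: e d => [k||a e IH|e1 IH1 e2 IH2|e1 IH1 e2 IH2] d //=.
- by rewrite !has_cat (negPf (IH _)) (negPf (nojump_caddr _ _)).
- by rewrite !has_cat (negPf (IH1 _)) (negPf (IH2 _)).
- by rewrite !has_cat (negPf (IH1 _)) (negPf (IH2 _)).
Qed.

Definition simulates (N : nat) (m : memory) (r : nat -> nat) : Prop :=
  r 0 = N /\ forall a i, r (cell a.+2 i) = m a i.

Lemma simulates_tmp N m d r r' :
  simulates N m r -> same_but_tmp d r r' -> simulates N m r'.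
Proof.
case=> r0 rm rr'; split=> [|a i]; rewrite rr' //.
by move=> d' _ /cell_inj[].
Qed.

Lemma straight_cexpr N m e d p r w : simulates N m r -> exists r',
  [/\ straight (cexpr e d) (Config p r w) = Config (p + size (cexpr e d)) r' w,
      r' (tmp d) = value N m e & same_but_tmp d r r'].
Proof.
elim: e d p r w =>
    [k||a e IH|e1 IH1 e2 IH2|e1 IH1 e2 IH2] d p r w sim_r /=.
- exists (set_reg r (tmp d) k); split; first by rewrite addn1.
    by rewrite /set_reg eqxx.
  exact: same_but_tmp_set.
- eexists; split; first by rewrite /straight /= addn2.
    rewrite /set_reg !eqxx tmp_eq0; by case: sim_r.
  by do 2![apply: same_but_tmp_set => //].
- have [r1 [E1 V1 S1]] := IH d p r w sim_r.
  have [r2 [E2 V2 S2]] := straight_caddr a.+2 d (p + size (cexpr e d)) r1 w.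
  have S12 := same_but_tmp_trans (leqnn d) S1 S2.
  exists (set_reg r2 (tmp d) (r2 (r2 (tmp d)))); split; last exact: same_but_tmp_set.
    rewrite !straight_cat E1 E2 /=.
    by congr Config; rewrite !size_cat /=; lia.
  rewrite /set_reg eqxx V2 V1.
  by have [_ ->] := simulates_tmp sim_r S12.
- have sim1 := simulates_tmp sim_r.
  have [r1 [E1 V1 S1]] := IH1 d p r w sim_r.
  have [r2 [E2 V2 S2]] := IH2 d.+1 (p + size (cexpr e1 d)) r1 w (sim1 _ _ S1).
  have S12 := same_but_tmp_trans (leqnSn d) S1 S2.
  exists (set_reg r2 (tmp d) (addn (r2 (tmp d)) (r2 (tmp d.+1)))); split.
  + by rewrite !straight_cat E1 E2 /=; congr Config; rewrite !size_cat /=; lia.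
  + by rewrite /set_reg eqxx V2 S2 ?V1 // => d' lt_d /cell_inj[_]; lia.
  + exact: same_but_tmp_set S12.
- have sim1 := simulates_tmp sim_r.
  have [r1 [E1 V1 S1]] := IH1 d p r w sim_r.
  have [r2 [E2 V2 S2]] := IH2 d.+1 (p + size (cexpr e1 d)) r1 w (sim1 _ _ S1).
  have S12 := same_but_tmp_trans (leqnSn d) S1 S2.
  exists (set_reg r2 (tmp d) (subn (r2 (tmp d)) (r2 (tmp d.+1)))); split.
  + by rewrite !straight_cat E1 E2 /=; congr Config; rewrite !size_cat /=; lia.
  + by rewrite /set_reg eqxx V2 S2 ?V1 // => d' lt_d /cell_inj[_]; lia.
  + exact: same_but_tmp_set S12.
Qed.

(** * Correctness and instruction count of compiled commands *)

Fixpoint steps (N : nat) (c : cmd) : nat :=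
  match c with
  | Put a e1 e2 => size (ccmd c 0 0)
  | Read a e => size (ccmd c 0 0)
  | Unless e c => (size (cexpr e 0)).+1 + steps N c
  | Seq c1 c2 => steps N c1 + steps N c2
  | Loop c => 2 + N * (steps N c + 3)
  end.

Definition same_cnt (d : nat) (r r' : nat -> nat) : Prop :=
  forall d', d' < d -> r' (cnt d') = r (cnt d').

Lemma same_but_tmp_cnt d d' r r' : same_but_tmp d r r' -> same_cnt d' r r'.
Proof. by move=> rr' i _; apply: rr' => j _ /cell_inj[]. Qed.

Lemma same_cnt_trans d r r' r'' :
  same_cnt d r r' -> same_cnt d r' r'' -> same_cnt d r r''.
Proof. by move=> rr' r'r'' i lt_i; rewrite r'r'' // rr'. Qed.

Lemma simulates_upd N m r a i v : simulates N m r ->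
  simulates N (upd m a i v) (set_reg r (cell a.+2 i) v).
Proof.
case=> r0 rm; split=> [|a' i']; rewrite /set_reg.
  by case: eqP => // E; have := cell_gt0 a.+2 i; rewrite -E.
rewrite /upd rm; case: eqP => [/cell_inj[[-> ->]]|Ncell]; first by rewrite !eqxx.
by case: andP => // -[/eqP Ea /eqP Ei]; case: Ncell; rewrite Ea Ei.
Qed.

Lemma simulates_cnt N m r d v :
  simulates N m r -> simulates N m (set_reg r (cnt d) v).
Proof.
case=> r0 rm; split=> [|a i]; rewrite /set_reg.
  by case: eqP => // E; have := cell_gt0 1 d; rewrite -[cell 1 d]E.
by case: eqP => [/cell_inj[]|].
Qed.

Lemma same_cnt_set d r r' j v : (forall d', d' < d -> cnt d' <> j) ->
  same_cnt d r r' -> same_cnt d r (set_reg r' j v).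
Proof.
by move=> Nj rr' i lt_i; rewrite /set_reg rr' //; case: eqP => // /(Nj _ lt_i).
Qed.

Lemma reach_cexpr N m pre e d post r w : simulates N m r -> exists r',
  [/\ reach (pre ++ cexpr e d ++ post) (size (cexpr e d))
            (Config (size pre) r w)
            (Config (size pre + size (cexpr e d)) r' w),
      r' (tmp d) = value N m e & same_but_tmp d r r'].
Proof.
move=> sim_r; have [r' [E V S]] := straight_cexpr e d (size pre) w sim_r.
by exists r'; split=> //; rewrite -E; apply/reach_straight/nojump_cexpr.
Qed.

Lemma reach_ccmd N pre c d post m r w : 0 < N -> simulates N m r ->
  exists t r', let s := eval N c (State m w) in
  let code := ccmd c d (size pre) in
  [/\ t <= steps N c,
      reach (pre ++ code ++ post) t (Config (size pre) r w)
            (Config (size pre + size code) r' (inp s)),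
      simulates N (mem s) r' & same_cnt d r r'].
Proof.
move=> N_gt0.
elim: c pre d post m r w =>
    [a e1 e2|a e|e c IH|c1 IH1 c2 IH2|c IH] pre d post m r w sim_r /=.
- set code1 := cexpr e1 0 ++ _; set code2 := cexpr e2 1 ++ _.
  have [r1 [E1 V1 S1]] := straight_cexpr e1 0 (size pre) w sim_r.
  have [r2 [E2 V2 S2]] :=
    straight_caddr a.+2 0 (size pre + size (cexpr e1 0)) r1 w.
  have S12 := same_but_tmp_trans (leqnn _) S1 S2.
  have [r3 [E3 V3 S3]] := straight_cexpr e2 1
    (size pre + size (cexpr e1 0) + size (caddr a.+2 0)) w (simulates_tmp sim_r S12).
  have S13 := same_but_tmp_trans (leqnSn _) S12 S3.
  have T3 : r3 (tmp 0) = cell a.+2 (value N m e1).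
    by rewrite S3 ?V2 ?V1 // => d' lt_d /cell_inj[_]; lia.
  exists (size (code1 ++ code2)), (set_reg r3 (r3 (tmp 0)) (r3 (tmp 1))); split=> //.
  + have := @reach_straight pre (code1 ++ code2) post r w.
    rewrite !straight_cat E1 E2 E3 /=; suff -> : (size pre + size (code1 ++ code2)) =
      (size pre + size (cexpr e1 0) + size (caddr a.+2 0) + size (cexpr e2 1)).+1.
      apply; rewrite !has_cat /=.
      by rewrite !(negPf (nojump_cexpr _ _)) (negPf (nojump_caddr _ _)).
    by rewrite !size_cat /=; lia.
  + by rewrite T3 V3; apply: simulates_upd; exact: simulates_tmp S13.
  + apply: same_cnt_set; last exact: same_but_tmp_cnt S13.
    by move=> d' _; rewrite T3 => /cell_inj[].
- set code1 := cexpr e 0 ++ _; set code2 := [:: _; _].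
  have [r1 [E1 V1 S1]] := straight_cexpr e 0 (size pre) w sim_r.
  have [r2 [E2 V2 S2]] :=
    straight_caddr a.+2 0 (size pre + size (cexpr e 0)) r1 w.
  have S12 := same_but_tmp_trans (leqnn _) S1 S2.
  set r3 := set_reg r2 (tmp 1) (head 0 w).
  have S13 : same_but_tmp 0 r r3 by apply: same_but_tmp_set.
  have T3 : r3 (tmp 0) = cell a.+2 (value N m e).
    by rewrite /r3 /set_reg /= V2 V1.
  exists (size (code1 ++ code2)), (set_reg r3 (r3 (tmp 0)) (r3 (tmp 1))); split=> //.
  + have := @reach_straight pre (code1 ++ code2) post r w.
    rewrite !straight_cat E1 E2 /=; suff -> : (size pre + size (code1 ++ code2)) =
      (size pre + size (cexpr e 0) + size (caddr a.+2 0)).+2.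
      apply; rewrite !has_cat /=.
      by rewrite !(negPf (nojump_cexpr _ _)) (negPf (nojump_caddr _ _)).
    by rewrite !size_cat /=; lia.
  + have -> : r3 (tmp 1) = head 0 w by rewrite /r3 /set_reg eqxx.
    by rewrite T3; apply: simulates_upd; exact: simulates_tmp S13.
  + apply: same_cnt_set; last exact: same_but_tmp_cnt S13.
    by move=> d' _; rewrite T3 => /cell_inj[].
- set test := cexpr e 0; set body := ccmd c d _.
  set jump := IJump _ _.
  have [r1 [R1 V1 S1]] := reach_cexpr pre e 0 (jump :: body ++ post) w sim_r.
  have {}sim_r1 := simulates_tmp sim_r S1.
  have cnt1 := same_but_tmp_cnt (d' := d) S1.
  have PJ : onth (pre ++ (test ++ jump :: body) ++ post) (size pre + size test)
            = Some jump.
    by rewrite -catA catA -size_cat /= onth_size_cat.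
  have -> : size pre + size (test ++ jump :: body)
      = (size pre + size test).+1 + size body by rewrite size_cat /=; lia.
  rewrite -/test -catA /= in R1 PJ *; case: eqP => [e0|Ne0].
    have [t [r' [le_t]]] := IH (pre ++ rcons test jump) d post _ r1 w sim_r1.
    rewrite size_cat size_rcons addnS -/body -catA cat_rcons => R sim' cnt'.
    exists (size test + t.+1), r'; split.
    + by lia.
    + apply: reach_trans R1 _; apply: (@reach_next _ (Config _ _ _) _ _ _ PJ) => /=.
      by rewrite V1 e0.
    + exact: sim'.
    + exact: same_cnt_trans cnt1 cnt'.
  exists (size test + 1), r1; split.
  + by rewrite addn1 leq_addr.
  + apply: reach_trans R1 _; apply: (@reach_next _ (Config _ _ _) _ _ _ PJ) => /=.
    rewrite V1 lt0n (introF eqP Ne0) /=.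
    exact: reach_refl.
  + by [].
  + exact: cnt1.
- set code1 := ccmd c1 d _; set code2 := ccmd c2 d _.
  have [t1 [r1 [le1 R1 sim1 cnt1]]] := IH1 pre d (code2 ++ post) m r w sim_r.
  case E : (eval N c1 (State m w)) R1 sim1 => [m1 w1] /= R1 sim1.
  have [t2 [r2 [le2 R2 sim2 cnt2]]] := IH2 (pre ++ code1) d post m1 r1 w1 sim1.
  exists (t1 + t2), r2; split=> //; first exact: leq_add.
    rewrite size_cat addnA -catA; apply: reach_trans R1 _.
    by move: R2; rewrite size_cat -!catA.
  exact: same_cnt_trans cnt1 cnt2.
- pose code1 := [:: IConst (cnt d) 0; IAdd (cnt d) (cnt d) 0]; set body := ccmd c _ _.
  set code2 := [:: IConst (tmp 0) 1; ISub (cnt d) (cnt d) (tmp 0);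
                  IJump (cnt d) (size pre).+2].
  pose P := pre ++ (code1 ++ body ++ code2) ++ post.
  pose r0 := set_reg (set_reg r (cnt d) 0) (cnt d) N.
  have size1 : size (pre ++ code1) = (size pre).+2 by rewrite size_cat addn2.
  have R0 : reach P 2 (Config (size pre) r w) (Config (size pre).+2 r0 w).
    have := @reach_straight pre code1 ((body ++ code2) ++ post) r w isT.
    rewrite /straight /=; suff -> :
      set_reg r (cnt d) 0 (cnt d) + set_reg r (cnt d) 0 0 = N by [].
    rewrite /set_reg eqxx; case: eqP => [E|_]; last by case: sim_r.
    by have := cell_gt0 1 d; rewrite -[cell 1 d]E.
  have sim0 : simulates N m r0 by do 2!apply: simulates_cnt.
  have cnt0 : same_cnt d r r0.
    by do 2![apply: same_cnt_set => [d' lt_d /cell_inj[_]|]; first lia].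
  (* The counter holds the number of rounds still to run. The induction starts at the loop body,
     after the two instructions that set the counter; a round costs three more to decrease and test
     it. *)
  suff loop k m0 w0 r1 : 0 < k -> simulates N m0 r1 -> r1 (cnt d) = k ->
    exists t r', let s := iter k (eval N c) (State m0 w0) in
      [/\ t <= k * (steps N c + 3),
          reach P t (Config (size pre).+2 r1 w0)
            (Config (size pre + (size body + 3).+2) r' (inp s)),
          simulates N (mem s) r' & same_cnt d r1 r'].
    have [|t [r' [le_t R sim' cnt']]] := loop N m w r0 N_gt0 sim0.
      by rewrite /r0 /set_reg eqxx.
    exists (2 + t), r'; split=> //.
    + by rewrite size_cat /=; apply: reach_trans R0 R.
    + exact: same_cnt_trans cnt0 cnt'.
  elim: k m0 w0 r1 => // k IHk m0 w0 r1 _ sim1 cnt1.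
  have [t1 [r2 [le1 R1 sim2 cnt2]]] :=
    IH (pre ++ code1) d.+1 (code2 ++ post) m0 r1 w0 sim1.
  case E : (eval N c (State m0 w0)) R1 sim2 => [m1 w1].
  rewrite size1 -/body /= => R1 sim2.
  pose r3 := set_reg (set_reg r2 (tmp 0) 1) (cnt d) k.
  have EP : (pre ++ code1) ++ body ++ code2 ++ post = P by rewrite /P !catA.
  have sim3 : simulates N m1 r3.
    apply: simulates_cnt; apply: simulates_tmp sim2 _.
    exact: (@same_but_tmp_set 0).
  have cnt3 : same_cnt d r1 r3.
    apply: same_cnt_set => [d' lt_d /cell_inj[_]|]; first lia.
    by apply: same_cnt_set => [d' lt_d /cell_inj[]|] // i lt_i; apply: cnt2; lia.
  have R2 : reach P 3 (Config ((size pre).+2 + size body) r2 w1)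
     (Config (if 0 < k then (size pre).+2 else size pre + (size body + 3).+2) r3 w1).
    have nth_code2 i : onth P ((size pre).+2 + size body + i) = onth (code2 ++ post) i.
      by rewrite -EP catA onth_cat size_cat size1 ltnNge leq_addr /= addKn.
    have cnt_tmp : (cnt d == tmp 0) = false by apply/eqP => /cell_inj[].
    have kE : set_reg r2 (tmp 0) 1 (cnt d) - set_reg r2 (tmp 0) 1 (tmp 0) = k.
      by rewrite /set_reg eqxx cnt_tmp (cnt2 d (ltnSn d)) cnt1 subn1.
    have [P0 [P1 P2]] := (nth_code2 0, (nth_code2 1, nth_code2 2)).
    rewrite addn0 in P0; rewrite addn1 in P1; rewrite addn2 in P2.
    apply: (@reach_next _ (Config _ _ _) _ _ _ P0).
    apply: (@reach_next _ (Config _ _ _) _ _ _ P1).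
    apply: (@reach_next _ (Config _ _ _) _ _ _ P2).
    rewrite /= kE -/r3 [r3 (cnt d)]/set_reg eqxx.
    suff -> : ((size pre).+2 + size body).+3 = size pre + (size body + 3).+2.
      exact: reach_refl.
    by lia.
  move: R1; rewrite EP => R1; have R12 := reach_trans R1 R2.
  have E' : eval N c (iter k (eval N c) (State m0 w0)) = iter k (eval N c) (State m1 w1).
    by rewrite -iterS iterSr E.
  rewrite E'; case: k IHk @r3 {cnt1 R2 E'} sim3 cnt3 R12 => [|k] IHk r3 sim3 cnt3 R12.
    by exists (t1 + 3), r3; split=> //; rewrite mul1n leq_add2r.
  have [|t' [r' [le' R' sim' cnt']]] := IHk m1 w1 r3 isT sim3.
    by rewrite /r3 /set_reg eqxx.
  exists (t1 + 3 + t'), r'; split=> //.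
  + by rewrite mulSn; apply: leq_add; rewrite ?leq_add2r.
  + exact: reach_trans R12 R'.
  + exact: same_cnt_trans cnt3 cnt'.
Qed.

(** * Polynomial running time of compiled programs *)

Lemma steps_poly c : exists k d, forall N, 0 < N -> steps N c <= k * N ^ d.
Proof.
elim: c => [a e1 e2|a e|e c [k [d IH]]
  |c1 [k1 [d1 IH1]] c2 [k2 [d2 IH2]]|c [k [d IH]]] /=.
- by eexists; exists 0 => N _; rewrite muln1.
- by eexists; exists 0 => N _; rewrite muln1.
- exists ((size (cexpr e 0)).+1 + k), d => N N_gt0; rewrite mulnDl leq_add ?IH //.
  by rewrite leq_pmulr // expn_gt0 N_gt0.
- exists (k1 + k2), (d1 + d2) => N N_gt0.
  have := IH1 _ N_gt0; have := IH2 _ N_gt0; rewrite expnD.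
  by have : 0 < N ^ d1 /\ 0 < N ^ d2; [rewrite !expn_gt0 N_gt0 | nia].
- exists (2 + (k + 3)), d.+1 => N N_gt0.
  have := IH _ N_gt0; rewrite expnS.
  by have : 0 < N ^ d; [rewrite expn_gt0 N_gt0 | nia].
Qed.

(** Register 0 serves twice: it is the loop bound during the run, and [computes_in] expects the
    result there, so the result is moved to it last. *)
Definition compile (c : cmd) (e : expr) : program :=
  IRead 0 :: ccmd c 0 1 ++ cexpr e 0 ++ [:: IConst (tmp 1) 0; IAdd 0 (tmp 0) (tmp 1)].

Lemma input_size_ge w : size w <= input_size w.
Proof.
rewrite /input_size -sum1_size; exact: leq_sum.
Qed.

Lemma small_input w : small (input_size w).+1 (Config 0 (fun=> 0) w).
Proof.
split=> [i|] /=; first by rewrite expn_gt0.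
rewrite /input_size; elim: w => //= k w IH; rewrite big_cons; apply/andP; split.
  apply: leq_trans (ltn_bitlen k) _; rewrite leq_exp2l //; lia.
apply: sub_all IH => j lt_j; apply: leq_trans lt_j _; rewrite leq_exp2l //; lia.
Qed.

Lemma simulates0 N : simulates N (fun _ _ => 0) (set_reg (fun=> 0) 0 N).
Proof.
split=> [|a i]; rewrite /set_reg //; case: eqP => // E.
by have := cell_gt0 a.+2 i; rewrite E.
Qed.

(** A number [N] alone would have an input size of only about log N; [N <= size w] is what makes a
    polynomial in [N] a polynomial in the input size. *)
Theorem compile_polytime (T : Type) (promise : T -> Prop)
    (encode : T -> seq nat) (answer : T -> nat) (c : cmd) (e : expr) :
  (forall z, promise z -> exists N w,
     [/\ encode z = N :: w, 0 < N <= size w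
       & value N (mem (eval N c (State (fun _ _ => 0) w))) e = answer z]) ->
  polytime_solvable promise encode answer.
Proof.
move=> correct; pose P := compile c e.
have [b sP] := small_const_exists P.
have [k [d le_steps]] := steps_poly c.
(* The 3 stands for the initial [IRead] and the two instructions that move the result. *)
pose K := k + (size (cexpr e 0) + 3).
(* There are at most [K * M ^ d] instructions for input size [M], each costing at most twice the bit
   length [b + M.+1 + K * M ^ d], which is at most [(b + 2 + K) * M ^ d.+1]. *)
exists P, (K * (2 * (b + 2 + K))), (d + d.+1).
move=> z /correct [N [w [Ez /andP[N_gt0 le_N] <-]]].
rewrite Ez; set M := input_size _.
have le_NM : N < M by apply: leq_trans (input_size_ge _); rewrite /= ltnS.
set s := eval N c _; pose r0 := set_reg (fun=> 0) 0 N.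
set code := cexpr e 0 ++ [:: IConst (tmp 1) 0; IAdd 0 (tmp 0) (tmp 1)].
have [t1 [r1 [le1 R1 sim1 _]]] :=
  @reach_ccmd N [:: IRead 0] c 0 code _ r0 w N_gt0 (simulates0 N).
have [r2 [R2 V2 S2]] := @reach_cexpr N _ ([:: IRead 0] ++ ccmd c 0 1) e 0
  [:: IConst (tmp 1) 0; IAdd 0 (tmp 0) (tmp 1)] r1 (inp s) sim1.
pose r3 := set_reg r2 (tmp 1) 0; pose r4 := set_reg r3 0 (r3 (tmp 0) + r3 (tmp 1)).
have sizeP : size P = (1 + size (ccmd c 0 1) + size (cexpr e 0)).+2.
  by rewrite /P /compile /= !size_cat /=; lia.
have R : reach P (1 + (t1 + (size (cexpr e 0) + 2))) (Config 0 (fun=> 0) (N :: w))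
               (Config (size P) r4 (inp s)).
  rewrite sizeP add1n; apply: (@reach_next _ (Config _ _ _) (IRead 0)) => //=.
  apply: (reach_trans R1); rewrite -/s.
  have := reach_trans R2; rewrite size_cat -catA -/code; apply.
  have PE : P = ([:: IRead 0] ++ ccmd c 0 1 ++ cexpr e 0) ++
      [:: IConst (tmp 1) 0; IAdd 0 (tmp 0) (tmp 1)] ++ [::].
    by rewrite /P /compile cats0 /= -!catA.
  have := @reach_straight ([:: IRead 0] ++ ccmd c 0 1 ++ cexpr e 0)
     [:: IConst (tmp 1) 0; IAdd 0 (tmp 0) (tmp 1)] [::] r2 (inp s) isT.
  by rewrite -PE !size_cat addnA.
have [||||t' run_t' le_t'] := @reach_runs P (b + M.+1) _ _ _ _ _ _ R.
- by rewrite addnS.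
- apply: sub_all sP => -[] //= _ j /leq_trans; apply.
  by rewrite leq_exp2l // leq_addr.
- have [lt_r lt_w] := small_input (N :: w); split=> [i|] /=; first by rewrite expn_gt0.
  by apply: sub_all lt_w => j /leq_trans; apply; rewrite leq_exp2l // leq_addl.
- exact: onth_default.
exists t'.
  exists (Config (size P) r4 (inp s)) => //=.
  by rewrite /r4 /r3 /set_reg /= V2 addn0.
apply: leq_trans le_t' _; apply: leq_trans (leq_addr _ _).
have Md_gt0 : 0 < M ^ d by rewrite expn_gt0 (leq_trans _ le_NM).
have le_t : 1 + (t1 + (size (cexpr e 0) + 2)) <= K * M ^ d.
  have le_NMd : N ^ d <= M ^ d.
    by case: (d) => // d'; rewrite leq_exp2r // ltnW.
  have le_t1 := leq_trans le1 (leq_trans (le_steps _ N_gt0) (leq_mul (leqnn k) le_NMd)).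
  have := leq_pmulr (size (cexpr e 0) + 3) Md_gt0.
  by rewrite /K mulnDl; lia.
have le_b : 2 * (b + M.+1 + K * M ^ d) <= 2 * (b + 2 + K) * M ^ d.+1.
  by rewrite expnS; have : 0 < M; [lia | nia].
apply: leq_trans (leq_mul le_t _) _.
  by apply: leq_trans le_b; rewrite leq_mul2l leq_add2l.
rewrite expnD mulnACA; exact: leqnn.
Qed.

(** * Decisions in star games *)

Definition chosen (V : finType) (P : pred V) (x : V -> bool) : nat :=
  \sum_(u | P u) x u.

(* [a], [b] and [e] count the chosen vertices among, respectively, the
   predecessors of the center which do not follow it, those which do, and the
   vertices whose decision is always their own choice; [y] is the choice of the
   center.  There are [m] and [r] vertices of the first two kinds, and [f]
   further followers. *)
Definition decide (q th m r f a b e : nat) (y : bool) : bool :=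
  if th <= a + b then q <= e + a + r + ((m - a < th) || y) + f
  else q <= e + a + (if y then r else b) + ((m + r - (a + b) < th) && y).

Section Star.
Variables (V : finType) (g : influence_game V).
Variables (L I R : {set V}) (c : V) (F : {set V}).
Hypothesis star : star_graph g L I R c F.
Hypothesis teamE : team g = L :|: R :|: I.
Hypothesis label_gt0 : positive_labels g.

Inductive star_class (u : V) : bool -> bool -> bool -> bool -> bool -> Prop :=
| ClassL : star_class u true false false false false
| ClassI : star_class u false true false false false
| ClassR : star_class u false false true false false
| ClassC : star_class u false false false true false
| ClassF : star_class u false false false false true.

Lemma star_classP u :
  star_class u (u \in L) (u \in I) (u \in R) (u == c) (u \in F).
Proof.
case: star => cover disj _; have := in_setT u; rewrite -cover !inE.
move: disj; rewrite /= !andbT -!setI_eq0.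
case/and4P=> /and4P[d1 d2 d3 d4] /and3P[d5 d6 d7] /andP[d8 d9] d10.
have dis (X Y : {set V}) : X :&: Y == set0 -> ~~ ((u \in X) && (u \in Y)).
  by move/eqP/setP/(_ u); rewrite !inE => ->.
move: (dis _ _ d1) (dis _ _ d2) (dis _ _ d3) (dis _ _ d4) (dis _ _ d5)
  (dis _ _ d6) (dis _ _ d7) (dis _ _ d8) (dis _ _ d9) (dis _ _ d10).
rewrite !inE.
by case: (u \in L); case: (u \in I); case: (u \in R); case: (u == c);
  case: (u \in F) => //= *; constructor.
Qed.

Lemma center_class : [/\ c \notin L, c \notin I, c \notin R & c \notin F].
Proof. by case: (star_classP c) (eqxx c). Qed.

Lemma star_edge u v : edge g u v =
  ((u \in L) || (u \in R)) && (v == c) || (u == c) && ((v \in R) || (v \in F)).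
Proof. by case: star => _ _ ->; rewrite !inE. Qed.

Lemma star_team u : (u \in team g) = [|| u \in L, u \in R | u \in I].
Proof. by rewrite teamE !inE orbA. Qed.

Lemma preds_center : preds g c = L :|: R.
Proof.
apply/setP=> u; rewrite !inE star_edge eqxx andbT.
by have [_ _ /negPf-> /negPf->] := center_class; rewrite andbF orbF.
Qed.

Lemma preds_leaf v : (v \in R) || (v \in F) -> preds g v = [set c].
Proof.
move=> RFv; apply/setP=> u; rewrite !inE star_edge RFv andbT.
by case: (star_classP v) RFv; rewrite ?andbF.
Qed.

Lemma preds_source v : (v \in L) || (v \in I) -> preds g v = set0.
Proof.
move=> LIv; apply/setP=> u; rewrite !inE star_edge.
by case: (star_classP v) LIv; rewrite ?andbF.
Qed.

(** * Closed form of the spread *)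

Definition convinced (S : {set V}) : bool :=
  (c \in S) || (label g c <= #|(L :|: R) :&: S|%:R)%R.

Definition followers : {set V} :=
  [set v | ((v \in R) || (v \in F)) && (label g v <= 1)%R].

Definition closure (S : {set V}) : {set V} :=
  if convinced S then c |: followers :|: S else S.

Lemma label_le0 v : (label g v <= 0)%R = false.
Proof. by apply/negbTE; rewrite -ltNge. Qed.

Lemma card_set1I (S : {set V}) : #|[set c] :&: S| = (c \in S).
Proof.
case: (boolP (c \in S)) => Sc; first by rewrite (setIidPl _) ?sub1set // cards1.
by apply/eqP; rewrite cards_eq0 setI_eq0 disjoints1.
Qed.

(** Here positivity of the labels enters: a source, or a leaf whose center is inactive, counts zero
    active predecessors and stays below its label. *)
Lemma closure_step S : spread_step g (closure S) \subset closure S.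
Proof.
apply/subsetP=> u; rewrite inE => /orP[//|]; rewrite inE.
have [conv|Nconv] := boolP (convinced S); last first.
  rewrite /closure (negPf Nconv); move: Nconv; rewrite negb_or => /andP[Nc Nle].
  have [->|u_c] := eqVneq u c; first by rewrite preds_center (negPf Nle).
  have [RFu|NRFu] := boolP ((u \in R) || (u \in F)).
    by rewrite (preds_leaf RFu) card_set1I (negPf Nc) label_le0.
  have [LIu|NLIu] := boolP ((u \in L) || (u \in I)).
    by rewrite (preds_source LIu) set0I cards0 label_le0.
  by case: (star_classP u) u_c NRFu NLIu.
rewrite /closure conv !inE; have [//|u_c] := eqVneq u c.
have [RFu|NRFu] := boolP ((u \in R) || (u \in F)).
  by rewrite (preds_leaf RFu) card_set1I !inE eqxx /= => ->.
have [LIu|NLIu] := boolP ((u \in L) || (u \in I)).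
  by rewrite (preds_source LIu) set0I cards0 label_le0.
by case: (star_classP u) u_c NRFu NLIu.
Qed.

Lemma spread_stepS (S T : {set V}) :
  S \subset T -> spread_step g S \subset spread_step g T.
Proof.
move=> sST; apply: setUSS => //; apply/subsetP=> u; rewrite !inE => /le_trans-> //.
by rewrite ler_nat subset_leq_card // setIS.
Qed.

Lemma subset_iter_spread k (S : {set V}) : S \subset iter k (spread_step g) S.
Proof. by elim: k => //= k /subset_trans-> //; apply: subsetUl. Qed.

(** The closure is stable under a step, so it bounds every iterate; conversely the center has
    entered by round one and its followers by round two. *)
Lemma spread_star S : spread g S = closure S.
Proof.
apply/eqP; rewrite eqEsubset; apply/andP; split.
  rewrite /spread; elim: #|V| => [|k IHk] /=.
    by rewrite /closure; case: ifP => // _; apply: subsetUr.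
  exact: subset_trans (spread_stepS IHk) (closure_step S).
have sS := subset_iter_spread; rewrite /closure /spread.
case: ifP => // conv; rewrite subUset sS andbT.
have V_gt0 : 0 < #|V| by apply/card_gt0P; exists c.
case EV: #|V| V_gt0 => [//|k] _.
have cS1 : c \in spread_step g S.
  by case/orP: conv => conv; rewrite !inE ?conv // preds_center conv orbT.
apply/subsetP=> u; rewrite 2!inE => /orP[/eqP->|].
  by rewrite iterSr; apply: subsetP cS1; apply: sS.
rewrite inE => /andP[RFu le1].
have u_c : u != c by case: (star_classP u) RFu.
(* With a single vertex there is no second round, but then the follower [u] would be the center. *)
case: k EV => [|k] EV.
  have /eqP := EV; rewrite -[#|V|]cardsT eqn_leq => /andP[/card_le1P].
  move/(_ u (in_setT _)) => /(_ c); rewrite !inE => /esym/eqP Euc.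
  by rewrite Euc eqxx in u_c.
rewrite 2!iterSr; apply: subsetP (sS _ _) _ _; rewrite 2!inE (preds_leaf RFu).
by rewrite card_set1I cS1 le1 orbT.
Qed.

(** * Classes of vertices and their recognition *)

Let easy (u : V) : bool := (label g u <= 1)%R.
(** One active predecessor cannot reach a label above 1. Hence such a vertex of [R] behaves as one
    of [L], and such a vertex of [F] as one of [I]. *)
Definition firm_pred : pred V := fun u => (u \in L) || (u \in R) && ~~ easy u.
Definition soft_pred : pred V := fun u => (u \in R) && easy u.
Definition independent : pred V := fun u => (u \in I) || (u \in F) && ~~ easy u.
Definition soft_leaf : pred V := fun u => (u \in F) && easy u.

(** Together with the team and the labels, these two tests can be evaluated on the input once the
    center is known; the lemmas below express the classes through them. *)
Let out (u : V) : bool := [exists v, edge g u v].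
Let inn (u : V) : bool := [exists v, edge g v u].

Lemma star_out u : u != c -> out u = (u \in L) || (u \in R).
Proof.
move=> /negPf uc; rewrite /out; apply/existsP/idP => [[v]|LRu].
  by rewrite star_edge uc orbF => /andP[].
by exists c; rewrite star_edge LRu eqxx.
Qed.

Lemma star_inn u : u != c -> inn u = (u \in R) || (u \in F).
Proof.
move=> /negPf uc; rewrite /inn; apply/existsP/idP => [[v]|RFu].
  by rewrite star_edge uc andbF => /andP[].
by exists c; rewrite star_edge RFu eqxx orbT.
Qed.

Lemma firm_predE u : firm_pred u =
  [&& u != c, u \in team g, out u & ~~ (inn u && easy u)].
Proof.
have [->|uc] := eqVneq u c.
  by have [/negPf cL _ /negPf cR _] := center_class; rewrite /firm_pred cL cR.
rewrite /firm_pred star_team star_out // star_inn //.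
by case: (star_classP u) uc => //=; rewrite ?andbF.
Qed.

Lemma soft_predE u : soft_pred u = [&& u != c, u \in team g, out u, inn u & easy u].
Proof.
have [->|uc] := eqVneq u c.
  by have [_ _ /negPf cR _] := center_class; rewrite /soft_pred cR.
rewrite /soft_pred star_team star_out // star_inn //.
by case: (star_classP u) uc.
Qed.

Lemma independentE u :
  independent u = (u != c) && (if u \in team g then ~~ out u else ~~ easy u).
Proof.
have [->|uc] := eqVneq u c.
  by have [_ /negPf cI _ /negPf cF] := center_class; rewrite /independent cI cF.
rewrite /independent star_team star_out //.
by case: (star_classP u) uc.
Qed.

Lemma soft_leafE u : soft_leaf u = [&& u != c, u \notin team g & easy u].
Proof.
have [->|uc] := eqVneq u c.
  by have [_ _ _ /negPf cF] := center_class; rewrite /soft_leaf cF.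
by rewrite /soft_leaf star_team; case: (star_classP u) uc.
Qed.

Lemma center_team : c \notin team g.
Proof. by rewrite star_team; have [/negPf-> /negPf-> /negPf->] := center_class. Qed.

(** Any other vertex outside the team lies in [F]: it has no successor, yet it is itself a successor
    of the center. *)
Lemma center_unique u : u \notin team g -> out u || ~~ out c -> u = c.
Proof.
move=> Tu outs; apply/eqP; apply: contraT => uc; move: outs.
have [NLR Fu] : ~~ ((u \in L) || (u \in R)) /\ u \in F.
  by move: Tu; rewrite star_team; case: (star_classP u) uc.
rewrite star_out // (negPf NLR) => /existsPn/(_ u).
by rewrite star_edge eqxx Fu !orbT.
Qed.

Lemma star_sum (d : V -> nat) : \sum_u d u =
  \sum_(u | firm_pred u) d u + \sum_(u | soft_pred u) d u + \sum_(u | independent u) d u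
  + \sum_(u | soft_leaf u) d u + d c.
Proof.
rewrite -[d c](big_pred1_eq addn) [\sum_(u | firm_pred u) _]big_mkcond.
rewrite [\sum_(u | soft_pred u) _]big_mkcond [\sum_(u | independent u) _]big_mkcond.
rewrite [\sum_(u | soft_leaf u) _]big_mkcond [\sum_(u | u == c) _]big_mkcond.
rewrite -!big_split /=; apply: eq_bigr => u _.
rewrite /firm_pred /soft_pred /independent /soft_leaf.
by case: (star_classP u) => /=; case: (easy u); rewrite ?addn0 ?add0n.
Qed.

Lemma card_preds_center (S : {set V}) : #|(L :|: R) :&: S| =
  chosen firm_pred (fun u => u \in S) + chosen soft_pred (fun u => u \in S).
Proof.
rewrite -sum1_card big_mkcond [chosen firm_pred _]big_mkcond.
rewrite [chosen soft_pred _]big_mkcond.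
rewrite -big_split; apply: eq_bigr => u _.
rewrite !inE /firm_pred /soft_pred.
by case: (star_classP u) => /=; case: (easy u); case: (u \in S).
Qed.

Lemma card_preds_centerD (S : {set V}) :
  #|(L :|: R) :\: S| = #|firm_pred| + #|soft_pred| - #|(L :|: R) :&: S|.
Proof.
rewrite cardsD; congr (_ - _); rewrite -!sum1_card big_mkcond.
rewrite [\sum_(u in firm_pred) _]big_mkcond.
rewrite [\sum_(u in soft_pred) _]big_mkcond -big_split /=; apply: eq_bigr => u _.
rewrite !inE -[u \in firm_pred]/(firm_pred u) -[u \in soft_pred]/(soft_pred u).
rewrite /firm_pred /soft_pred.
by case: (star_classP u) => /=; case: (easy u).
Qed.

(** Keeps the counts compared with the label of the center in the range where a truncated ceiling is
    exact. *)
Lemma ltn_preds_center (S : {set V}) : #|(L :|: R) :&: S| < #|V|.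
Proof.
rewrite -cardsT; apply: proper_card; apply/properP; split=> [|]; first exact: subsetT.
exists c; rewrite ?inE //.
by have [/negPf-> _ /negPf-> _] := center_class.
Qed.

(** Makes the counts valid digits in base [n]. *)
Lemma chosen_ltn (P : pred V) x : ~~ P c -> chosen P x < #|V|.
Proof.
move=> Pc; apply: (@leq_ltn_trans #|P|).
  by rewrite -sum1_card; apply: leq_sum => u _; case: (x u).
rewrite -cardsT; apply: proper_card; apply/properP; split.
  by apply/subsetP => u _; rewrite inE.
by exists c; rewrite ?inE.
Qed.

Lemma ltn_preds_centerD (S : {set V}) : #|(L :|: R) :\: S| < #|V|.
Proof. by rewrite setDE ltn_preds_center. Qed.

(** * Individual and collective decisions *)

Section Decision.
Variables (x : {ffun V -> bool}) (th : nat).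
Hypothesis thP : forall k, k < #|V| -> (label g c <= k%:R)%R = (th <= k).

Let a := chosen firm_pred x.
Let b := chosen soft_pred x.
Let convincing : bool := th <= a + b.

Lemma card_chosen : #|(L :|: R) :&: support_of x| = a + b.
Proof.
rewrite card_preds_center /a /b /chosen.
by congr (_ + _); apply: eq_bigr => u _; rewrite /= inE.
Qed.

Lemma convinced_support : convinced (support_of x) = x c || convincing.
Proof.
rewrite /convinced thP ?ltn_preds_center // card_chosen inE; congr (_ || _).
Qed.

Lemma convinced_team : convinced (support_of x :&: team g) = convincing.
Proof.
have [/negPf cL /negPf cI /negPf cR _] := center_class.
rewrite /convinced thP ?ltn_preds_center // !inE teamE !inE cL cR cI andbF /=.
rewrite /convincing -card_chosen; congr (_ <= #|pred_of_set _|).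
apply/setP=> u; rewrite !inE.
by case: (star_classP u); rewrite ?andbT.
Qed.

Lemma mem_closure S u : (u \in closure S) =
  (u \in S) || convinced S && ((u == c) || (u \in followers)).
Proof. by rewrite /closure; case: ifP; rewrite ?orbF // !inE orbC. Qed.

Lemma active_leaf u : u \in F ->
  active_preds g x u = convincing /\ inactive_preds g x u = ~~ convincing.
Proof.
move=> Fu; have cS : (c \in spread g (support_of x :&: team g)) = convincing.
  rewrite spread_star mem_closure convinced_team eqxx andbT !inE star_team.
  by have [/negPf-> /negPf-> /negPf-> _] := center_class; rewrite andbF.
rewrite /active_preds /inactive_preds preds_leaf ?Fu ?orbT //.
by rewrite setIC cardsD cards1 card_set1I cS; case: convincing.
Qed.

Lemma label_gtr0 u : (0 < label g u)%R.
Proof. exact: label_gt0. Qed.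

Lemma decision_leaf u : u \in F ->
  final_decision g x u = if easy u then convincing else x u.
Proof.
move=> Fu; have [p q] := active_leaf Fu.
rewrite /final_decision p q star_team /easy.
case: (star_classP u) Fu => // _ /=.
by case: convincing; rewrite /= !label_le0 ?label_gtr0 ?andbT ?andbF /=; case: ifP.
Qed.

Lemma decision_team u : u \in team g ->
  final_decision g x u = x u || soft_pred u && (x c || convincing).
Proof.
rewrite /final_decision => Tu; rewrite Tu spread_star mem_closure inE.
rewrite convinced_support inE star_team in Tu *; rewrite /soft_pred /easy.
by case: (star_classP u) Tu => //= _; rewrite ?andbF // ?orbF andbC.
Qed.

(** There is feedback: a convinced center wins over the soft predecessors that voted no, and these
    then count among its active predecessors. *)
Lemma active_center : active_preds g x c =
  if convincing then a + #|soft_pred| else a + b.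
Proof.
rewrite /active_preds preds_center setIC card_preds_center spread_star /chosen.
have memE u : (u == c) = false -> (u \in closure (support_of x :&: team g)) =
    (x u && (u \in team g)) || convincing && (u \in followers).
  by move=> uc; rewrite mem_closure convinced_team uc !inE.
rewrite [X in X + _](eq_bigr (fun u => x u : nat)) => [|u]; last first.
  rewrite /firm_pred => Au; have uc : (u == c) = false by case: (star_classP u) Au.
  rewrite (memE _ uc) star_team inE -/(easy u); move: Au.
  case: (star_classP u) => //=; rewrite ?andbT ?andbF ?orbF //.
  by move=> /negPf ->; rewrite andbF orbF.
rewrite [X in _ + X](eq_bigr (fun u => x u || convincing : nat)) => [|u]; last first.
  rewrite /soft_pred => Bu; have uc : (u == c) = false by case: (star_classP u) Bu.
  rewrite (memE _ uc) star_team inE; move: Bu; rewrite /easy => /andP[Ru ->].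
  by rewrite Ru !orbT !andbT.
case: ifP => Lit; congr (_ + _).
  by rewrite -sum1_card; apply: eq_bigr => u _; rewrite orbT.
by apply: eq_bigr => u _; rewrite orbF.
Qed.

(** If the team convinces the center, feedback only adds supporters, so they still reach [th]; the
    decision is yes unless the opponents reach [th] too, and then the own vote counts. Otherwise the
    supporters stay below [th], and only opponents can overrule the own vote. *)
Lemma decision_center : final_decision g x c =
  if convincing then (#|firm_pred| - a < th) || x c
  else (#|firm_pred| + #|soft_pred| - (a + b) < th) && x c.
Proof.
have Lc : c \in team g = false.
  by rewrite star_team; have [/negPf-> /negPf-> /negPf->] := center_class.
have E : inactive_preds g x c = #|firm_pred| + #|soft_pred| - active_preds g x c.
  rewrite /inactive_preds /active_preds preds_center card_preds_centerD.
  by rewrite [in RHS]setIC.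
have p_lt : active_preds g x c < #|V|.
  by rewrite /active_preds preds_center setIC ltn_preds_center.
have q_lt : inactive_preds g x c < #|V|.
  by rewrite /inactive_preds preds_center ltn_preds_centerD.
rewrite /final_decision Lc !ltNge !thP // E active_center -!ltnNge.
have leB : b <= #|soft_pred|.
  by rewrite /b /chosen -sum1_card; apply: leq_sum => u _; case: (x u).
rewrite /convincing; case: (leqP th (a + b)) => th_le.
  have -> : th <= a + #|soft_pred| by lia.
  have -> : #|firm_pred| + #|soft_pred| - (a + #|soft_pred|) = #|firm_pred| - a by lia.
  case: (ltnP (#|firm_pred| - a) th) => //= th_q.
  by rewrite ltnNge (leq_trans th_le) ?leq_add2l.
rewrite [th <= _]leqNgt th_le /=.
by case: (ltnP (#|firm_pred| + #|soft_pred| - (a + b)) th).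
Qed.

(** The vote of the center acts unevenly. Team members decide by the spread of the whole vote, so a
    yes of the center brings in all soft predecessors even when the team does not convince it.
    Followers outside the team see only the spread of the team, so soft leaves count in the
    convinced case alone. *)
Lemma collective_star : collective_decision g x =
  decide (quota g) th #|firm_pred| #|soft_pred| #|soft_leaf|
    a b (chosen independent x) (x c).
Proof.
rewrite /collective_decision -sum1_card big_mkcond.
pose d u := (if u \in [set i | final_decision g x i] then 1 else 0).
have dE u : d u = final_decision g x u by rewrite /d inE; case: final_decision.
have AE : \sum_(u | firm_pred u) d u = a.
  apply: eq_bigr => u; rewrite dE /firm_pred => Au; rewrite decision_team.
    by rewrite /soft_pred; case/orP: Au; case: (star_classP u);
      case: (easy u); rewrite ?orbF.
  by rewrite star_team; case/orP: Au => [->|/andP[->]]; rewrite ?orbT.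
have EE : \sum_(u | independent u) d u = chosen independent x.
  apply: eq_bigr => u; rewrite dE /independent => /orP[Iu|/andP[Fu /negPf Nu]].
    rewrite decision_team ?star_team ?Iu ?orbT // /soft_pred.
    by case: (star_classP u) Iu; rewrite ?orbF.
  by rewrite decision_leaf // Nu.
have BE : \sum_(u | soft_pred u) d u = if convincing || x c then #|soft_pred| else b.
  have dB u : soft_pred u -> d u = x u || x c || convincing.
    move=> Bu; rewrite dE decision_team ?Bu ?orbA // star_team.
    by case/andP: Bu => ->; rewrite orbT.
  case: ifP => [Hlit|/norP[/negPf l0 /negPf c0]].
    rewrite -sum1_card; apply: eq_bigr => u /dB->.
    by case/orP: Hlit => ->; rewrite !orbT.
  by apply: eq_bigr => u /dB->; rewrite l0 c0 !orbF.
have DE : \sum_(u | soft_leaf u) d u = if convincing then #|soft_leaf| else 0.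
  have dD u : soft_leaf u -> d u = convincing.
    by case/andP => Fu eu; rewrite dE decision_leaf // eu.
  case: ifP => Hlit.
    by rewrite -sum1_card; apply: eq_bigr => u /dD->; rewrite Hlit.
  by apply: big1 => u /dD->; rewrite Hlit.
rewrite -[X in _ <= X]/(\sum_u d u) star_sum AE EE BE DE dE.
rewrite decision_center /decide -/convincing.
case: convincing => /=; congr (_ <= _); first by lia.
by case: (x c) => /=; lia.
Qed.
End Decision.
End Star.

(** * The algorithm *)

(** A static overapproximation: a write at a computed index counts as a write to the whole row. For
    a concrete program it evaluates to a boolean, so frame conditions hold by computation. *)
Fixpoint modifies (c : cmd) (a i : nat) : bool :=
  match c with
  | Put a' e _ | Read a' e => (a' == a) && (if e is Cst k then k == i else true)
  | Unless _ c | Loop c => modifies c a i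
  | Seq c1 c2 => modifies c1 a i || modifies c2 a i
  end.

Fixpoint reads (c : cmd) : bool :=
  match c with
  | Put _ _ _ => false
  | Read _ _ => true
  | Unless _ c | Loop c => reads c
  | Seq c1 c2 => reads c1 || reads c2
  end.

Lemma eval_frame N c a i s :
  ~~ modifies c a i -> mem (eval N c s) a i = mem s a i.
Proof.
have upd_frame m a' e v :
    ~~ ((a' == a) && (if e is Cst k then k == i else true)) ->
    upd m a' (value N m e) v a i = m a i.
  rewrite /upd [a == a']eq_sym; case: eqP => //= _.
  by case: e => //= k; rewrite eq_sym => /negPf->.
elim: c s => [a' e e'|a' e|e c IH|c1 IH1 c2 IH2|c IH] s /=; try exact: upd_frame.
- by move=> Nc; case: ifP => // _; apply: IH.
- by rewrite negb_or => /andP[/IH1 E1 /IH2->].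
- move=> Nc; have H k : mem (iter k (eval N c) s) a i = mem s a i; last exact: H.
  by elim: k => //= k; rewrite IH.
Qed.

Lemma eval_inp N c s : ~~ reads c -> inp (eval N c s) = inp s.
Proof.
elim: c s => [a' e e'|a' e|e c IH|c1 IH1 c2 IH2|c IH] s //=.
- by move=> Nc; case: ifP => // _; apply: IH.
- by rewrite negb_or => /andP[/IH1 E1 /IH2->].
- move=> Nc; have H k : inp (iter k (eval N c) s) = inp s; last exact: H.
  by elim: k => //= k; rewrite IH.
Qed.

Lemma eval_seq N c1 c2 s : eval N (Seq c1 c2) s = eval N c2 (eval N c1 s).
Proof. by []. Qed.

Lemma eval_loop N c s : eval N (Loop c) s = iter N (eval N c) s.
Proof. by []. Qed.

Lemma mem_unless N e c s a i : mem (eval N (Unless e c) s) a i =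
  if value N (mem s) e == 0 then mem (eval N c s) a i else mem s a i.
Proof. by rewrite /=; case: ifP. Qed.

Lemma mem_put N a e v s a' i : mem (eval N (Put a e v) s) a' i =
  if (a' == a) && (i == value N (mem s) e) then value N (mem s) v
  else mem s a' i.
Proof. by []. Qed.

Lemma mem_read N a e s a' i : mem (eval N (Read a e) s) a' i =
  if (a' == a) && (i == value N (mem s) e) then head 0 (inp s)
  else mem s a' i.
Proof. by []. Qed.

Lemma inp_read N a e s : inp (eval N (Read a e) s) = behead (inp s).
Proof. by []. Qed.

(* The invariant need not mention the cells which the body never writes. *)
Lemma loop_inv (Inv : nat -> state -> Prop) N c s : Inv 0 s ->
  (forall k s', k < N -> (forall a i, ~~ modifies c a i -> mem s' a i = mem s a i) ->
     Inv k s' -> Inv k.+1 (eval N c s')) ->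
  Inv N (eval N (Loop c) s).
Proof.
move=> Inv0 IH; have H k : k <= N -> Inv k (iter k (eval N c) s); last exact: H.
elim: k => //= k IHk lt_k; apply: IH => //; last by apply: IHk; apply: ltnW.
by move=> a i Nc; elim: k {IHk lt_k} => //= k; rewrite eval_frame.
Qed.

Opaque eval.

(** Evaluates a cell symbolically; a command that provably leaves the cell alone is skipped before
    any unfolding is tried. *)
Ltac lookup := repeat (first
  [ match goal with
    | |- context [mem (eval ?N ?c ?s) ?a ?i] =>
        rewrite (@eval_frame N c a i s isT)
    end
  | rewrite eval_seq | rewrite mem_put | rewrite mem_unless | rewrite mem_read
  | match goal with
    | |- context [inp (eval ?N ?c ?s)] => rewrite (@eval_inp N c s isT)
    end
  | rewrite inp_read ]; rewrite /=).

Local Notation "$ i" := (Get 0 (Cst i)) (at level 2, format "$ i").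
Local Notation "i <:- e" := (Put 0 (Cst i) e) (at level 60).
Local Notation "c1 ;; c2" := (Seq c1 c2) (at level 70, right associativity).
Local Notation "e1 .+ e2" := (Add e1 e2) (at level 50, left associativity).
Local Notation "e1 .- e2" := (Sub e1 e2) (at level 50, left associativity).

(* Row 0 of the memory holds the scalar variables, rows 1 to 4 the arrays. *)
Local Notation quota_ := 0 (only parsing).
Local Notation actor_ := 1 (only parsing).
Local Notation row_ := 2 (only parsing).
Local Notation col_ := 3 (only parsing).
Local Notation center_ := 4 (only parsing).
Local Notation found_ := 5 (only parsing).
Local Notation n2_ := 6 (only parsing).
Local Notation n3_ := 7 (only parsing).
Local Notation num_ := 8 (only parsing).
Local Notation den_ := 9 (only parsing).
Local Notation w_ := 10 (only parsing).
Local Notation th_ := 11 (only parsing).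
Local Notation acc_ := 12 (only parsing).
Local Notation m_ := 13 (only parsing).
Local Notation r_ := 14 (only parsing).
Local Notation f_ := 15 (only parsing).
Local Notation key_ := 16 (only parsing).
Local Notation a_ := 17 (only parsing).
Local Notation b_ := 18 (only parsing).
Local Notation e_ := 19 (only parsing).
Local Notation t_ := 20 (only parsing).
Local Notation total_ := 21 (only parsing).
Local Notation answer_ := 22 (only parsing).
Local Notation isc_ := 23 (only parsing).
Local Notation tm_ := 24 (only parsing).
Local Notation out_ := 25 (only parsing).
Local Notation in_ := 26 (only parsing).
Local Notation easy_ := 27 (only parsing).

Local Notation Out := 1 (only parsing).
Local Notation In := 2 (only parsing).
Local Notation Team := 3 (only parsing).
Local Notation Table := 4 (only parsing).

(** Tests are arithmetic on 0 and 1: a sum vanishes when all its terms do, and [Cst 1 .- e] is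
    negation. In the same way [u .- v] vanishes when [u <= v], and [u .+ Cst 1 .- v] when
    [u < v]. *)
Definition classify : cmd :=
  w_ <:- Cst 0 ;;
  Unless (Cst 1 .- $isc_) (w_ <:- $n3_) ;;
  Unless ($isc_ .+ (Cst 1 .- $tm_) .+ $out_) (w_ <:- $n2_) ;;
  Unless ($isc_ .+ $tm_ .+ $easy_) (w_ <:- $n2_) ;;
  Unless ($isc_ .+ $tm_ .+ (Cst 1 .- $easy_)) (f_ <:- $f_ .+ Cst 1) ;;
  Unless ($isc_ .+ (Cst 1 .- $tm_) .+ (Cst 1 .- $out_)) (
    Unless (Cst 2 .- ($in_ .+ $easy_)) (w_ <:- Size ;; r_ <:- $r_ .+ Cst 1) ;;
    Unless ($in_ .+ $easy_ .- Cst 1) (w_ <:- Cst 1 ;; m_ <:- $m_ .+ Cst 1)).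

(** Each class gets the place value of its digit. An easy vertex outside the team other than the
    center weighs 0, since it decides as the team makes the center do, whatever its own vote. *)
Definition class_weight (N n2 n3 : nat) (isc tm out inn easy : bool) : nat :=
  if isc then n3 else
  if tm then if out then if inn && easy then N else 1 else n2 else
  if easy then 0 else n2.

Lemma eval_classify N s (isc tm out inn easy : bool) (s' := eval N classify s) :
  mem s 0 isc_ = isc -> mem s 0 tm_ = tm -> mem s 0 out_ = out ->
  mem s 0 in_ = inn -> mem s 0 easy_ = easy ->
  [/\ mem s' 0 w_ = class_weight N (mem s 0 n2_) (mem s 0 n3_) isc tm out inn easy,
      mem s' 0 m_ = mem s 0 m_ + [&& ~~ isc, tm, out & ~~ (inn && easy)],
      mem s' 0 r_ = mem s 0 r_ + [&& ~~ isc, tm, out, inn & easy]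
    & mem s' 0 f_ = mem s 0 f_ + [&& ~~ isc, ~~ tm & easy]].
Proof.
rewrite /s' /classify => Ec Et Eo Ei Ee.
by split; lookup; rewrite ?(Ec, Et, Eo, Ei, Ee);
  move: isc tm out inn easy {Ec Et Eo Ei Ee} => [] [] [] [] []; rewrite ?addn0.
Qed.

(** * The threshold of the center *)

Definition threshold_step : cmd :=
  Unless ($acc_ .+ Cst 1 .- $num_) (th_ <:- $th_ .+ Cst 1) ;;
  acc_ <:- $acc_ .+ $den_.

Definition threshold : cmd :=
  th_ <:- Cst 0 ;; acc_ <:- Cst 0 ;; Loop threshold_step.

(** For positive [den], the ceiling of [num / den] cut off at [N]. Counting against a running
    multiple of [den] avoids multiplication and division, which the language lacks. *)
Definition ceil_ratio (N num den : nat) : nat := \sum_(j < N) (j * den < num).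

(** The counted indices form an initial segment, so there are at most [k] of them exactly when [k]
    is not one. *)
Lemma ceil_ratioP N num den k : k < N -> (num <= k * den) = (ceil_ratio N num den <= k).
Proof.
move=> lt_k; rewrite /ceil_ratio; apply/idP/idP => [le_num|].
  have -> : \sum_(j < N) (j * den < num) = \sum_(j < N | j < k) (j * den < num).
    rewrite [RHS]big_mkcond; apply: eq_bigr => j _; case: (ltnP j k) => // le_kj.
    by rewrite ltnNge (leq_trans le_num) ?leq_mul2r ?le_kj ?orbT.
  rewrite (big_ord_narrow (ltnW lt_k)) -[k in _ <= k]card_ord -sum1_card.
  by apply: leq_sum => j _; case: (_ < _).
apply: contraTT; rewrite -!ltnNge => lt_num.
rewrite (bigID (fun j : 'I_N => j < k.+1)) (big_ord_narrow lt_k) /=.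
rewrite (eq_bigr (fun=> 1)) ?sum1_card ?card_ord ?leq_addr // => j _.
by rewrite (leq_ltn_trans _ lt_num) // leq_mul2r -ltnS ltn_ord orbT.
Qed.

Lemma eval_threshold N s : mem (eval N threshold s) 0 th_ =
  ceil_ratio N (mem s 0 num_) (mem s 0 den_).
Proof.
rewrite /threshold 2!eval_seq; set s1 := eval N (acc_ <:- Cst 0) _.
pose Inv k s' := [/\ mem s' 0 th_ = ceil_ratio k (mem s 0 num_) (mem s 0 den_)
  & mem s' 0 acc_ = k * mem s 0 den_].
suff: Inv N (eval N (Loop threshold_step) s1) by case.
apply: loop_inv => [|k s2 lt_k frame [E1 E2]].
  by split; rewrite /s1; lookup; rewrite // /ceil_ratio big_ord0.
have [E3 E4] : mem s2 0 num_ = mem s 0 num_ /\ mem s2 0 den_ = mem s 0 den_.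
  by rewrite !frame // /s1; lookup.
split; lookup; rewrite ?(E1, E2, E3, E4) //; last by rewrite mulSn addnC.
rewrite /ceil_ratio big_ord_recr /= addn1 subn_eq0.
by case: ltnP; rewrite ?addn1 ?addn0.
Qed.

(** * The subset sum table *)

Definition Repeat4 (c : cmd) : cmd := c ;; c ;; c ;; c.
Definition Loop3 (c : cmd) : cmd := Loop (Loop (Loop c)).

(* The keys are visited downwards, so that the table can be updated in place. *)
Definition knapsack_step : cmd :=
  key_ <:- $key_ .- Cst 1 ;;
  Unless ($w_ .- $key_) (
    Put Table $key_ (Get Table $key_ .+ Get Table ($key_ .- $w_))).

(** Every loop runs [N] times, so the [4 * N ^ 3] keys, three digits and two bits, are covered by
    four triple loops. *)
Definition knapsack : cmd :=
  key_ <:- $n3_ .+ $n3_ .+ $n3_ .+ $n3_ ;; Repeat4 (Loop3 knapsack_step).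

Lemma eval_Repeat4_Loop3 N c s :
  eval N (Repeat4 (Loop3 c)) s = iter (4 * N ^ 3) (eval N c) s.
Proof.
have E3 s' : eval N (Loop3 c) s' = iter (N ^ 3) (eval N c) s'.
  rewrite /Loop3 !expnS muln1 iterM eval_loop; apply: eq_iter => s2.
  by rewrite iterM eval_loop; apply: eq_iter => s3; rewrite eval_loop.
by rewrite /Repeat4 !eval_seq !E3 -!iterD; congr iter; lia.
Qed.

Lemma eval_knapsack N s j : mem s 0 n3_ = N ^ 3 -> j < 4 * N ^ 3 ->
  mem (eval N knapsack s) Table j = mem s Table j +
    (if mem s 0 w_ <= j then mem s Table (j - mem s 0 w_) else 0).
Proof.
move=> En3 lt_j; rewrite /knapsack eval_seq eval_Repeat4_Loop3.
set s1 := eval _ _ _; set S := 4 * N ^ 3 in lt_j *; set w := mem s 0 w_.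
pose new i := mem s Table i + (if w <= i then mem s Table (i - w) else 0).
(* After [k] rounds exactly the top [k] cells are new. The cell at [key - w] lies no higher than the
   current one and so is still old; for [w = 0] the current cell is doubled, as it should be. *)
have H k : k <= S -> let s' := iter k (eval N knapsack_step) s1 in
  [/\ mem s' 0 key_ = S - k, mem s' 0 w_ = w &
      forall i, mem s' Table i = if S - k <= i < S then new i else mem s Table i].
  elim: k => [|k IHk] le_k.
    split; rewrite /= /s1; lookup => //; first by rewrite En3 /S; lia.
    by move=> i; lookup; rewrite subn0; case: ltnP; rewrite ?andbF.
  have [Ekey Ew Etab] := IHk (ltnW le_k); rewrite /= in Ekey Ew Etab *.
  set s2 := iter k _ _ in Ekey Ew Etab *.
  rewrite /knapsack_step; split=> [||i]; lookup; rewrite ?Ekey ?Ew //; first lia.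
  rewrite !Etab subn_eq0; have -> : S - k - 1 = S - k.+1 by lia.
  have [->|Ni] := eqVneq i (S - k.+1).
    have -> : (S - k <= S - k.+1 - w) = false by lia.
    have -> : (S - k <= S - k.+1) = false by lia.
    have -> : S - k.+1 <= S - k.+1 < S by lia.
    by rewrite /new /=; case: (leqP w _); rewrite ?addn0.
  rewrite if_same; congr (if _ then _ else _); lia.
have [_ _ ->] := H S (leqnn S).
by rewrite subnn lt_j.
Qed.

(** * Summation over all keys *)

Definition enum_step (z y : bool) : cmd :=
  Unless ($th_ .- ($a_ .+ $b_)) (
    t_ <:- Cst y ;;
    Unless ($m_ .- $a_ .+ Cst 1 .- $th_) (t_ <:- Cst 1) ;;
    total_ <:- $e_ .+ $a_ .+ $r_ .+ $t_ .+ $f_) ;;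
  Unless ($a_ .+ $b_ .+ Cst 1 .- $th_) (
    t_ <:- Cst 0 ;;
    Unless ($m_ .+ $r_ .- ($a_ .+ $b_) .+ Cst 1 .- $th_) (t_ <:- Cst y) ;;
    total_ <:- $e_ .+ $a_ .+ (if y then $r_ else $b_) .+ $t_) ;;
  Unless (if z then $quota_ .- $total_ else $total_ .+ Cst 1 .- $quota_) (
    answer_ <:- $answer_ .+ Get Table $key_) ;;
  key_ <:- $key_ .+ Cst 1.

Definition enum_a (z y : bool) : cmd :=
  a_ <:- Cst 0 ;; Loop (enum_step z y ;; a_ <:- $a_ .+ Cst 1).
Definition enum_b (z y : bool) : cmd :=
  b_ <:- Cst 0 ;; Loop (enum_a z y ;; b_ <:- $b_ .+ Cst 1).
Definition enum_e (z y : bool) : cmd :=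
  e_ <:- Cst 0 ;; Loop (enum_b z y ;; e_ <:- $e_ .+ Cst 1).

Definition decides (s : state) (a b e : nat) (y : bool) : bool :=
  decide (mem s 0 quota_) (mem s 0 th_) (mem s 0 m_) (mem s 0 r_) (mem s 0 f_) a b e y.

Lemma decides_frame N c s a b e y :
  ~~ [|| modifies c 0 quota_, modifies c 0 th_, modifies c 0 m_, modifies c 0 r_
     | modifies c 0 f_] ->
  decides (eval N c s) a b e y = decides s a b e y.
Proof.
by rewrite !negb_or /decides => /and5P[? ? ? ? ?]; rewrite !eval_frame.
Qed.

Lemma eval_enum_step N z y s (s' := eval N (enum_step z y) s) :
  mem s' 0 answer_ = mem s 0 answer_ +
    (decides s (mem s 0 a_) (mem s 0 b_) (mem s 0 e_) y == z)
      * mem s Table (mem s 0 key_) /\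
  mem s' 0 key_ = mem s 0 key_ + 1.
Proof.
rewrite {}/s' /enum_step /decides /decide; split; last by case: y z => [] []; lookup.
case: y z => [] []; lookup;
  rewrite !subn_eq0 !addn1 ?(orbT, orbF, andbT, andbF, if_same);
  case: (leqP (mem s 0 th_) (mem s 0 a_ + mem s 0 b_)) => _;
  case: (mem s 0 m_ - mem s 0 a_ < mem s 0 th_);
  case: (mem s 0 m_ + mem s 0 r_ - (mem s 0 a_ + mem s 0 b_) < mem s 0 th_);
  by rewrite ?addn0; case: leqP; rewrite ?mul1n ?mul0n ?addn0.
Qed.

Lemma eval_enum_a N z y s (s' := eval N (enum_a z y) s) :
  mem s' 0 answer_ = mem s 0 answer_ + \sum_(a < N)
    (decides s a (mem s 0 b_) (mem s 0 e_) y == z) * mem s Table (mem s 0 key_ + a) /\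
  mem s' 0 key_ = mem s 0 key_ + N.
Proof.
rewrite {}/s' /enum_a eval_seq; set s1  := eval N (_ <:- _) s.
pose Inv k (s0 : state) := [/\ mem s0 0 a_ = k, mem s0 0 key_ = mem s 0 key_ + k &
  mem s0 0 answer_ = mem s 0 answer_ + \sum_(a < k)
    (decides s a (mem s 0 b_) (mem s 0 e_) y == z) * mem s Table (mem s 0 key_ + a)].
suff: Inv N (eval N (Loop (enum_step z y ;; a_ <:- $a_ .+ Cst 1)) s1) by case.
apply: loop_inv => [|k s2 lt_k frame [Ea Ek Ean]].
  by split; rewrite /s1; lookup; rewrite ?addn0 ?big_ord0 ?addn0.
have [E1 E2] := eval_enum_step N z y s2.
have frT j : mem s2 Table j = mem s Table j by rewrite frame // /s1; lookup.
have [Ee Eb] : mem s2 0 e_ = mem s 0 e_ /\ mem s2 0 b_ = mem s 0 b_.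
  by rewrite !frame // /s1; lookup.
have Ed a b e : decides s2 a b e y = decides s a b e y.
  by rewrite /decides !frame // -!/(decides _ _ _ _ _) decides_frame.
have Ea3 : mem (eval N (enum_step z y) s2) 0 a_ = k by rewrite eval_frame.
rewrite eval_seq; move: (eval N (enum_step z y) s2) E1 E2 Ea3 => s3 E1 E2 Ea3.
split; lookup; rewrite ?E1 ?E2 ?Ea3 ?Ea ?Ek ?Ean ?Ee ?Eb ?frT ?Ed ?addn1 ?addnS //.
by rewrite big_ord_recr /= addnA.
Qed.

Lemma eval_enum_b N z y s (s' := eval N (enum_b z y) s) :
  mem s' 0 answer_ = mem s 0 answer_ + \sum_(b < N) \sum_(a < N)
    (decides s a b (mem s 0 e_) y == z) * mem s Table (mem s 0 key_ + b * N + a) /\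
  mem s' 0 key_ = mem s 0 key_ + N * N.
Proof.
rewrite {}/s' /enum_b eval_seq; set s1 := eval N (_ <:- _) s.
pose Inv k (s0 : state) := [/\ mem s0 0 b_ = k, mem s0 0 key_ = mem s 0 key_ + k * N &
  mem s0 0 answer_ = mem s 0 answer_ + \sum_(b < k) \sum_(a < N)
    (decides s a b (mem s 0 e_) y == z) * mem s Table (mem s 0 key_ + b * N + a)].
suff: Inv N (eval N (Loop (enum_a z y ;; b_ <:- $b_ .+ Cst 1)) s1) by case.
apply: loop_inv => [|k s2 lt_k frame [Eb Ek Ean]].
  by split; rewrite /s1; lookup; rewrite ?addn0 ?big_ord0 ?addn0.
have [E1 E2] := eval_enum_a N z y s2.
have frT j : mem s2 Table j = mem s Table j by rewrite frame // /s1; lookup.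
have Ee : mem s2 0 e_ = mem s 0 e_ by rewrite !frame // /s1; lookup.
have Ed a b e : decides s2 a b e y = decides s a b e y.
  by rewrite /decides !frame // -!/(decides _ _ _ _ _) decides_frame.
have Eb3 : mem (eval N (enum_a z y) s2) 0 b_ = k by rewrite eval_frame.
rewrite eval_seq; move: (eval N (enum_a z y) s2) E1 E2 Eb3 => s3 E1 E2 Eb3.
split; lookup; rewrite ?E1 ?E2 ?Eb3 ?Eb ?Ek ?Ean ?Ee ?addn1 //.
  by rewrite mulSn addnAC addnA.
rewrite big_ord_recr /= addnA; congr (_ + _); apply: eq_bigr => a _.
by rewrite Ed frT.
Qed.

Lemma eval_enum_e N z y s (s' := eval N (enum_e z y) s) :
  mem s' 0 answer_ = mem s 0 answer_ +
    \sum_(e < N) \sum_(b < N) \sum_(a < N) (decides s a b e y == z)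
      * mem s Table (mem s 0 key_ + e * (N * N) + b * N + a) /\
  mem s' 0 key_ = mem s 0 key_ + N ^ 3.
Proof.
rewrite {}/s' /enum_e eval_seq; set s1 := eval N (_ <:- _) s.
pose Inv k (s0 : state) := [/\ mem s0 0 e_ = k,
  mem s0 0 key_ = mem s 0 key_ + k * (N * N) &
  mem s0 0 answer_ = mem s 0 answer_ +
    \sum_(e < k) \sum_(b < N) \sum_(a < N) (decides s a b e y == z)
      * mem s Table (mem s 0 key_ + e * (N * N) + b * N + a)].
rewrite !expnS muln1.
suff: Inv N (eval N (Loop (enum_b z y ;; e_ <:- $e_ .+ Cst 1)) s1) by case.
apply: loop_inv => [|k s2 lt_k frame [Ee Ek Ean]].
  by split; rewrite /s1; lookup; rewrite ?addn0 ?big_ord0 ?addn0.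
have [E1 E2] := eval_enum_b N z y s2.
have frT j : mem s2 Table j = mem s Table j by rewrite frame // /s1; lookup.
have Ed a b e : decides s2 a b e y = decides s a b e y.
  by rewrite /decides !frame // -!/(decides _ _ _ _ _) decides_frame.
have Ee3 : mem (eval N (enum_b z y) s2) 0 e_ = k by rewrite eval_frame.
rewrite eval_seq; move: (eval N (enum_b z y) s2) E1 E2 Ee3 => s3 E1 E2 Ee3.
split; lookup; rewrite ?E1 ?E2 ?Ee3 ?Ee ?Ek ?Ean ?addn1 //.
  by rewrite mulSn addnAC addnA.
rewrite big_ord_recr /= addnA; congr (_ + _); apply: eq_bigr => b _.
by apply: eq_bigr => a _; rewrite Ed frT.
Qed.

(** The two bits are parameters of the program text, so the code occurs four times. The copies come
    in increasing order of [y + 2 * z] and the loops run through the digits with [a] fastest, so the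
    key is just incremented throughout. *)
Definition enum_all : cmd :=
  key_ <:- Cst 0 ;; answer_ <:- Cst 0 ;; enum_e false false ;; enum_e false true ;;
  enum_e true false ;; enum_e true true.

Lemma eval_enum_all N s : mem (eval N enum_all s) 0 answer_ =
  \sum_(z : bool) \sum_(y : bool) \sum_(e < N) \sum_(b < N) \sum_(a < N)
    (decides s a b e y == z) * mem s Table (a + N * (b + N * (e + N * (y + 2 * z)))).
Proof.
rewrite /enum_all 5!eval_seq; set s0 := eval N (answer_ <:- Cst 0) _.
have [A1 K1] := eval_enum_e N false false s0.
set s1 := eval N (enum_e false false) s0 in A1 K1 *.
have [A2 K2] := eval_enum_e N false true s1.
set s2 := eval N (enum_e false true) s1 in A2 K2 *.
have [A3 K3] := eval_enum_e N true false s2.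
set s3 := eval N (enum_e true false) s2 in A3 K3 *.
have [A4 K4] := eval_enum_e N true true s3.
have E0 : [/\ mem s0 0 answer_ = 0, mem s0 0 key_ = 0,
   forall j, mem s0 Table j = mem s Table j &
   forall a b e y, decides s0 a b e y = decides s a b e y].
  by split=> *; rewrite /s0; lookup => //; rewrite !decides_frame.
case: E0 => A0 K0 T0 D0.
have T1 j : mem s1 Table j = mem s Table j by rewrite /s1 eval_frame.
have T2 j : mem s2 Table j = mem s Table j by rewrite /s2 eval_frame.
have T3 j : mem s3 Table j = mem s Table j by rewrite /s3 eval_frame.
have D1 a b e y : decides s1 a b e y = decides s a b e y by rewrite /s1 decides_frame.
have D2 a b e y : decides s2 a b e y = decides s a b e y by rewrite /s2 decides_frame.
have D3 a b e y : decides s3 a b e y = decides s a b e y by rewrite /s3 decides_frame.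
pose S (z y : bool) := \sum_(e < N) \sum_(b < N) \sum_(a < N)
    (decides s a b e y == z) * mem s Table (a + N * (b + N * (e + N * (y + 2 * z)))).
have sumE (s' : state) (z y : bool) : (forall j, mem s' Table j = mem s Table j) ->
    (forall a b e, decides s' a b e y = decides s a b e y) ->
    mem s' 0 key_ = N ^ 3 * (y + 2 * z) ->
    \sum_(e < N) \sum_(b < N) \sum_(a < N) (decides s' a b e y == z)
      * mem s' Table (mem s' 0 key_ + e * (N * N) + b * N + a) = S z y.
  move=> T D K; apply: eq_bigr => e _; apply: eq_bigr => b _; apply: eq_bigr => a _.
  rewrite D T K !expnS; congr (_ * mem _ _ _); lia.
clearbody s3 s2 s1 s0.
rewrite A4 (sumE s3) ?D3 //; last by rewrite K3 K2 K1 K0; lia.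
rewrite A3 (sumE s2) ?D2 //; last by rewrite K2 K1 K0; lia.
rewrite A2 (sumE s1) ?D1 //; last by rewrite K1 K0; lia.
rewrite A1 (sumE s0) ?D0 //; last by rewrite K0; lia.
transitivity (\sum_(z : bool) \sum_(y : bool) S z y); last by [].
by rewrite A0 (big_bool _ (fun z => \sum_(y : bool) S z y)) /= !big_bool /=; lia.
Qed.

(** * Reading the graph and finding the center *)

Lemma head_drop (w : seq nat) p : head 0 (drop p w) = nth 0 w p.
Proof. by rewrite -nth0 nth_drop addn0. Qed.

Lemma behead_drop (w : seq nat) p : behead (drop p w) = drop p.+1 w.
Proof. by rewrite -drop1 drop_drop add1n. Qed.

(** The matrix is not stored: row and column sums tell whether a vertex has a successor or a
    predecessor. *)
Definition read_entry : cmd :=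
  Read 0 (Cst t_) ;; Put Out $row_ (Get Out $row_ .+ $t_) ;;
  Put In $col_ (Get In $col_ .+ $t_) ;; col_ <:- $col_ .+ Cst 1.
Definition read_row : cmd :=
  col_ <:- Cst 0 ;; Loop read_entry ;; row_ <:- $row_ .+ Cst 1.

Lemma eval_read_row N s w p (s' := eval N read_row s) : inp s = drop p w ->
  [/\ mem s' 0 row_ = mem s 0 row_ + 1, inp s' = drop (p + N) w,
      forall i, mem s' Out i = mem s Out i +
        (i == mem s 0 row_) * \sum_(j < N) nth 0 w (p + j)
    & forall j, mem s' In j = mem s In j + (j < N) * nth 0 w (p + j)].
Proof.
rewrite {}/s' /read_row 2!eval_seq => Ew; set s1 := eval N (_ <:- _) s.
pose Inv k (s0 : state) := [/\ mem s0 0 col_ = k, inp s0 = drop (p + k) w,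
  forall i, mem s0 Out i = mem s Out i +
        (i == mem s 0 row_) * \sum_(j < k) nth 0 w (p + j)
  & forall j, mem s0 In j = mem s In j + (j < k) * nth 0 w (p + j)].
have: Inv N (eval N (Loop read_entry) s1).
  apply: loop_inv => [|k s2 lt_k frame [E1 E2 E3 E4]].
    by split=> [||i|i]; rewrite /s1; lookup; rewrite ?addn0 // big_ord0 muln0 addn0.
  have Er : mem s2 0 row_ = mem s 0 row_ by rewrite frame // /s1; lookup.
  have Et : head 0 (inp s2) = nth 0 w (p + k) by rewrite E2 head_drop.
  split=> [||i|j]; lookup; rewrite ?E1 ?Er ?Et ?addn1 //.
  - by rewrite E2 behead_drop addnS.
  - rewrite !E3 big_ord_recr /=; case: eqP => [->|_]; last by rewrite !mul0n.
    by rewrite eqxx !mul1n addnA.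
  - rewrite !E4 ltnS [j <= k]leq_eqVlt; case: eqP => [->|_] //=.
    by rewrite ltnn addn0 mul1n.
have Er2 : mem (eval N (Loop read_entry) s1) 0 row_ = mem s 0 row_.
  by rewrite eval_frame // /s1; lookup.
move: (eval N (Loop read_entry) s1) Er2 => s2 Er2 [E1 E2 E3 E4].
by split=> *; lookup; rewrite ?Er2.
Qed.

Definition read_matrix : cmd := Loop read_row.

Lemma eval_read_matrix N s w (s' := eval N read_matrix s) : inp s = w ->
  mem s 0 row_ = 0 -> (forall i, mem s Out i = 0) -> (forall i, mem s In i = 0) ->
  [/\ inp s' = drop (N * N) w,
      forall i, i < N -> mem s' Out i = \sum_(j < N) nth 0 w (i * N + j)
    & forall j, j < N -> mem s' In j = \sum_(i < N) nth 0 w (i * N + j)].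
Proof.
rewrite {}/s' => Ew row0 out0 in0.
pose Inv k (s0 : state) := [/\ mem s0 0 row_ = k, inp s0 = drop (k * N) w,
  forall i, mem s0 Out i = (i < k) * \sum_(j < N) nth 0 w (i * N + j)
  & forall j, j < N -> mem s0 In j = \sum_(i < k) nth 0 w (i * N + j)].
suff [_ E1 E2 E3] : Inv N (eval N read_matrix s).
  by split=> // i lt_i; rewrite E2 lt_i mul1n.
apply: loop_inv => [|k s2 lt_k _ [E1 E2 E3 E4]].
  by split=> [||i|j _]; rewrite ?drop0 ?out0 ?in0 ?big_ord0.
have [F1 F2 F3 F4] := eval_read_row N E2; split.
- by rewrite F1 E1 addn1.
- by rewrite F2 mulSn addnC.
- move=> i; rewrite F3 E3 E1 ltnS [i <= k]leq_eqVlt.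
  by case: eqP => [->|_]; rewrite ?ltnn ?mul0n ?addn0.
- by move=> j lt_j; rewrite F4 E4 // lt_j mul1n big_ord_recr.
Qed.

(* Only the center can have an outgoing edge among the vertices outside the
   team, and it is the only vertex outside the team when it has none. *)
Definition read_team_step : cmd :=
  Read Team $row_ ;;
  Unless (Get Team $row_ .+ $found_) (
    center_ <:- $row_ ;; found_ <:- Get Out $row_) ;;
  row_ <:- $row_ .+ Cst 1.
Definition read_team : cmd := row_ <:- Cst 0 ;; Loop read_team_step.

Lemma eval_read_team N s w p (s' := eval N read_team s) (c := mem s' 0 center_) :
  inp s = drop p w -> mem s 0 found_ = 0 ->
  [/\ inp s' = drop (p + N) w,
      forall i, i < N -> mem s' Team i = nth 0 w (p + i),
      forall i, i < N -> nth 0 w (p + i) = 0 -> c < N /\ nth 0 w (p + c) = 0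
    & forall i, i < N -> nth 0 w (p + i) = 0 -> 0 < mem s Out i -> 0 < mem s Out c].
Proof.
rewrite {}/c {}/s' /read_team eval_seq => Ew found0; set s1 := eval N (_ <:- _) s.
(* The candidate is the last vertex seen outside the team until one with a successor occurs;
   [found_] then holds its positive outdegree and freezes the choice. *)
pose Inv k (s0 : state) (c := mem s0 0 center_) (fnd := mem s0 0 found_) :=
  [/\ mem s0 0 row_ = k, inp s0 = drop (p + k) w,
      forall i, i < k -> mem s0 Team i = nth 0 w (p + i),
      forall i, i < k -> nth 0 w (p + i) = 0 -> c < k /\ nth 0 w (p + c) = 0
    & (0 < fnd -> [/\ c < k, nth 0 w (p + c) = 0 & 0 < mem s Out c]) /\
      (fnd = 0 -> forall i, i < k -> nth 0 w (p + i) = 0 -> mem s Out i = 0)].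
have: Inv N (eval N (Loop read_team_step) s1).
  apply: loop_inv => [|k s2 lt_k frame [E1 E2 E3 E4 [E5 E6]]].
    by split=> // [|]; rewrite /s1; lookup; rewrite ?addn0 ?found0.
  have Eo i : mem s2 Out i = mem s Out i by rewrite frame // /s1; lookup.
  rewrite /Inv; lookup; rewrite E1 E2 !eqxx Eo head_drop behead_drop addn_eq0.
  split; rewrite ?addn1 ?addnS //.
  - move=> i; lookup; rewrite E1 E2 head_drop ltnS leq_eqVlt.
    by case: eqP => [->|_] //=; apply: E3.
  - move=> i; rewrite ltnS leq_eqVlt => /predU1P[->|lt_i] Ti.
      rewrite Ti /=; case: eqP => [_|/eqP f1]; first by rewrite ltnSn.
      by have [|lt_c ->] := E5; rewrite ?lt0n // ltnW.
    have [lt_c Tc] := E4 _ lt_i Ti.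
    case: ifP => [/andP[/eqP Tk _]|_]; rewrite ?ltnSn //.
    by rewrite ltnW.
  - case: ifP => [/andP[/eqP Tk /eqP f0]|NT]; split.
    + by rewrite ltnSn.
    + move=> Ok0 i; rewrite ltnS leq_eqVlt => /predU1P[->//|lt_i]; exact: E6.
    + by move=> /E5[lt_c Tc Oc]; rewrite ltnW.
    + move=> f0 i; rewrite ltnS leq_eqVlt => /predU1P[->|lt_i] Ti; last exact: E6.
      by rewrite Ti f0 in NT.
have Eo i : mem (eval N (Loop read_team_step) s1) Out i = mem s Out i.
  by rewrite eval_frame // /s1; lookup.
move: (eval N (Loop read_team_step) s1) Eo => s2 Eo [E1 E2 E3 E4 [E5 E6]].
split=> // i lt_i Ti Oi; rewrite ?Eo.
have [f0|f1] := posnP (mem s2 0 found_); last by have [] := E5 f1.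
by rewrite (E6 f0 i) in Oi.
Qed.

(** * Initial table and the pass over the vertices *)

Definition setup : cmd :=
  Loop (n2_ <:- $n2_ .+ Size) ;; Loop (n3_ <:- $n3_ .+ $n2_) ;;
  Put Table (Cst 0) (Cst 1).

Lemma eval_setup N s (s' := eval N setup s) :
  mem s 0 n2_ = 0 -> mem s 0 n3_ = 0 -> (forall j, mem s Table j = 0) ->
  [/\ mem s' 0 n2_ = N ^ 2, mem s' 0 n3_ = N ^ 3 &
      forall j, mem s' Table j = (j == 0)].
Proof.
rewrite {}/s' /setup 2!eval_seq => E2 E3 ET.
set s1 := eval N (Loop _) s.
have F2 : mem s1 0 n2_ = N ^ 2.
  apply: (@loop_inv (fun k s' => mem s' 0 n2_ = k * N)) => [|k s2 _ _ E]; lookup.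
    by rewrite E2.
  by rewrite E mulSn addnC.
have {}E3 : mem s1 0 n3_ = 0 by rewrite /s1; lookup.
have {}ET j : mem s1 Table j = 0 by rewrite /s1; lookup.
clearbody s1; set s2 := eval N (Loop _) s1.
have F3 : mem s2 0 n3_ = N ^ 3.
  rewrite expnS -F2; apply: (@loop_inv (fun k s' => mem s' 0 n3_ = k * mem s1 0 n2_)).
    by rewrite E3.
  by move=> k s3 _ frame E; lookup; rewrite E (frame 0 n2_) // mulSn addnC.
have {}F2 : mem s2 0 n2_ = N ^ 2 by rewrite /s2; lookup.
have {}ET j : mem s2 Table j = 0 by rewrite /s2; lookup.
clearbody s2; split; lookup => // j; lookup.
by rewrite ET; case: eqP.
Qed.

Definition prepare : cmd :=
  Read 0 (Cst num_) ;; Read 0 (Cst den_) ;;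
  isc_ <:- Cst 1 .- ($row_ .- $center_ .+ ($center_ .- $row_)) ;;
  tm_ <:- Get Team $row_ ;;
  out_ <:- Cst 1 .- (Cst 1 .- Get Out $row_) ;;
  in_ <:- Cst 1 .- (Cst 1 .- Get In $row_) ;;
  easy_ <:- Cst 1 .- ($num_ .- $den_).

(** Added to the weight of the class instead of replacing it, so that one vote can feed two
    digits. *)
Definition add_actor : cmd :=
  Unless ($row_ .- $actor_ .+ ($actor_ .- $row_)) (w_ <:- $w_ .+ ($n3_ .+ $n3_)).

Definition process_step : cmd :=
  prepare ;; classify ;; Unless (Cst 1 .- $isc_) threshold ;; add_actor ;; knapsack ;;
  row_ <:- $row_ .+ Cst 1.

Lemma eval_process_step N s w p (s' := eval N process_step s)
    (u := mem s 0 row_) (tm : bool) (isc := u == mem s 0 center_)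
    (out := 0 < mem s Out u) (inn := 0 < mem s In u)
    (num := nth 0 w p) (den := nth 0 w p.+1) (easy := num <= den)
    (wt := class_weight N (mem s 0 n2_) (mem s 0 n3_) isc tm out inn easy
           + (u == mem s 0 actor_) * (2 * N ^ 3)) :
  inp s = drop p w -> mem s 0 n3_ = N ^ 3 -> mem s Team u = tm ->
  [/\ [/\ mem s' 0 row_ = u.+1, inp s' = drop p.+2 w
       & mem s' 0 th_ = if isc then ceil_ratio N num den else mem s 0 th_],
      [/\ mem s' 0 m_ = mem s 0 m_ + [&& ~~ isc, tm, out & ~~ (inn && easy)],
          mem s' 0 r_ = mem s 0 r_ + [&& ~~ isc, tm, out, inn & easy]
        & mem s' 0 f_ = mem s 0 f_ + [&& ~~ isc, ~~ tm & easy]]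
    & forall j, j < 4 * N ^ 3 -> mem s' Table j =
        mem s Table j + (if wt <= j then mem s Table (j - wt) else 0)].
Proof.
rewrite {}/s' => Ew E3 Etm; rewrite /process_step eval_seq.
set s1 := eval N prepare s.
have nz k : 1 - (1 - k) = (0 < k) by case: k.
have eqn_sub i j : 1 - (i - j + (j - i)) = (i == j).
  by rewrite eqn_leq -!subn_eq0 -addn_eq0; case: (_ + _).
have [F1 F2 F3 F4 F5] : [/\ mem s1 0 isc_ = isc, mem s1 0 tm_ = tm, mem s1 0 out_ = out,
    mem s1 0 in_ = inn & mem s1 0 easy_ = easy].
  split; rewrite /s1 /prepare; lookup; rewrite ?nz ?eqn_sub //.
  by rewrite Ew behead_drop !head_drop /easy /num /den; case: leqP; lia.
have [Fn Fd Fi] : [/\ mem s1 0 num_ = num, mem s1 0 den_ = den & inp s1 = drop p.+2 w].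
  by split; rewrite /s1 /prepare; lookup; rewrite ?Ew ?behead_drop ?head_drop.
have G i : i \in [:: row_; actor_; n2_; n3_; th_; m_; r_; f_] -> mem s1 0 i = mem s 0 i.
  by move=> Ii; apply/eqP; move: i Ii; apply/allP; rewrite /= /s1 !eval_frame ?eqxx.
have T1 j : mem s1 Table j = mem s Table j by rewrite /s1 eval_frame.
have [C1 C2 C3 C4] := eval_classify N F1 F2 F3 F4 F5.
rewrite !G // in C1 C2 C3 C4.
rewrite eval_seq; set s2 := eval N classify s1 in C1 C2 C3 C4 *.
have [R2 A2 N2 H2] : [/\ mem s2 0 row_ = u, mem s2 0 actor_ = mem s 0 actor_,
    mem s2 0 n3_ = N ^ 3 & mem s2 0 th_ = mem s 0 th_].
  by split; rewrite /s2 eval_frame ?G.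
have {}F1 : mem s2 0 isc_ = isc by rewrite /s2 eval_frame.
have {}Fn : mem s2 0 num_ = num by rewrite /s2 eval_frame.
have {}Fd : mem s2 0 den_ = den by rewrite /s2 eval_frame.
have {}Fi : inp s2 = drop p.+2 w by rewrite /s2 eval_inp.
have {}T1 j : mem s2 Table j = mem s Table j by rewrite /s2 eval_frame.
clearbody s2 => {s1 F2 F3 F4 F5 G}.
rewrite 2!eval_seq; set s3 := eval N add_actor _.
have th3 : mem s3 0 th_ = if isc then ceil_ratio N num den else mem s 0 th_.
  rewrite /s3 eval_frame // mem_unless /= F1 eval_threshold Fn Fd H2.
  by case: (isc).
have w3 : mem s3 0 w_ = wt.
  rewrite /s3 /add_actor mem_unless mem_put /= !(@eval_frame _ (Unless _ threshold)) //.
  rewrite R2 A2 N2 C1 /wt addn_eq0 !subn_eq0 -eqn_leq.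
  by case: eqP => _; rewrite ?mul0n ?addn0 // mul1n mul2n addnn.
have R3 : mem s3 0 row_ = u by rewrite /s3 !eval_frame.
have N3 : mem s3 0 n3_ = N ^ 3 by rewrite /s3 !eval_frame.
have D2 : mem s3 0 m_ = mem s2 0 m_ by rewrite /s3 !eval_frame.
have D3 : mem s3 0 r_ = mem s2 0 r_ by rewrite /s3 !eval_frame.
have D4 : mem s3 0 f_ = mem s2 0 f_ by rewrite /s3 !eval_frame.
have {}Fi : inp s3 = drop p.+2 w by rewrite /s3 !eval_inp.
have {}T1 j : mem s3 Table j = mem s Table j by rewrite /s3 !eval_frame.
clearbody s3; rewrite eval_seq.
have K := eval_knapsack N3.
have F i : ~~ modifies knapsack 0 i -> mem (eval N knapsack s3) 0 i = mem s3 0 i.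
  exact: eval_frame.
have I := @eval_inp N knapsack s3 isT.
move: (eval N knapsack s3) K F I => s4 K F I.
rewrite Fi in I; split.
- by split; lookup; rewrite ?F // ?R3 ?addn1.
- by split; lookup; rewrite F // ?D2 ?D3 ?D4.
- by move=> j lt_j; lookup; rewrite K // w3 !T1.
Qed.

Definition process : cmd := row_ <:- Cst 0 ;; Loop process_step.

Definition vertex_weight (N c act : nat) (tm out inn easy : nat -> bool) (u : nat) :=
  class_weight N (N ^ 2) (N ^ 3) (u == c) (tm u) (out u) (inn u) (easy u)
  + (u == act) * (2 * N ^ 3).

Definition subset_sums (wt : nat -> nat) (k : nat) : {poly nat} :=
  (\prod_(i < k) (1 + 'X^(wt i)))%R.

(** One more factor of the product is one run of [knapsack]. *)
Lemma subset_sumsS wt k j : ((subset_sums wt k.+1)`_j)%R = ((subset_sums wt k)`_j)%R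
  + (if wt k <= j then ((subset_sums wt k)`_(j - wt k)%N)%R else 0) :> nat.
Proof.
rewrite /subset_sums big_ord_recr /= GRing.mulrDr GRing.mulr1 coefD coefMXn.
by case: leqP.
Qed.

Lemma eval_process N s w p (tm : nat -> bool) (s' := eval N process s)
    (c := mem s 0 center_) (out := fun u => 0 < mem s Out u)
    (inn := fun u => 0 < mem s In u)
    (num := fun u => nth 0 w (p + u.*2)) (den := fun u => nth 0 w (p + u.*2).+1)
    (easy := fun u => num u <= den u)
    (wt := vertex_weight N c (mem s 0 actor_) tm out inn easy) :
  inp s = drop p w -> mem s 0 n2_ = N ^ 2 -> mem s 0 n3_ = N ^ 3 ->
  (forall u, u < N -> mem s Team u = tm u) ->
  (forall j, mem s Table j = (j == 0)) ->
  mem s 0 m_ = 0 -> mem s 0 r_ = 0 -> mem s 0 f_ = 0 -> c < N ->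
  [/\ mem s' 0 th_ = ceil_ratio N (num c) (den c),
      [/\ mem s' 0 m_ = \sum_(u < N)
            [&& u != c :> nat, tm u, out u & ~~ (inn u && easy u)],
          mem s' 0 r_ = \sum_(u < N) [&& u != c :> nat, tm u, out u, inn u & easy u]
        & mem s' 0 f_ = \sum_(u < N) [&& u != c :> nat, ~~ tm u & easy u]]
    & forall j, j < 4 * N ^ 3 -> mem s' Table j = ((subset_sums wt N)`_j)%R].
Proof.
rewrite {}/s' /process eval_seq => Ew E2 E3 Etm ET m0 r0 f0 lt_c.
set s1 := eval N (_ <:- _) s.
pose Inv k (s' : state) := [/\ [/\ mem s' 0 row_ = k, inp s' = drop (p + k.*2) w
      & (c < k -> mem s' 0 th_ = ceil_ratio N (num c) (den c))],
      [/\ mem s' 0 m_ = \sum_(u < k)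
            [&& u != c :> nat, tm u, out u & ~~ (inn u && easy u)],
          mem s' 0 r_ = \sum_(u < k) [&& u != c :> nat, tm u, out u, inn u & easy u]
        & mem s' 0 f_ = \sum_(u < k) [&& u != c :> nat, ~~ tm u & easy u]]
    & forall j, j < 4 * N ^ 3 -> mem s' Table j = ((subset_sums wt k)`_j)%R].
suff [[_ _ H1] H2 H3] : Inv N (eval N (Loop process_step) s1).
  by split=> //; apply: H1.
apply: loop_inv => [|k s2 lt_k frame [[I1 I2 I3] [I4 I5 I6] I7]].
  split; first by split; rewrite /s1; lookup; rewrite ?addn0.
    by rewrite !big_ord0; split; rewrite /s1; lookup.
  move=> j _; rewrite /s1; lookup.
  by rewrite ET /subset_sums big_ord0 coef1; case: (j == 0).
have Fr a i : ~~ modifies process_step a i -> ~~ modifies (row_ <:- Cst 0) a i ->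
    mem s2 a i = mem s a i.
  by move=> N1 N2; rewrite frame // /s1 eval_frame.
have [] := @eval_process_step N s2 w (p + k.*2) (tm k) I2.
- by rewrite Fr.
- by rewrite I1 Fr // Etm.
rewrite I1 (Fr 0 center_) // (Fr 0 n2_) // (Fr 0 n3_) // (Fr 0 actor_) //.
rewrite (Fr Out k) // (Fr In k) // E2 E3 -/c -/(easy k) -/(out k) -/(inn k).
rewrite -[class_weight _ _ _ _ _ _ _ _ + _]/(wt k) /Inv.
move: (eval N process_step s2) => s3 [-> -> ->] [-> -> ->] Etab.
split; first split=> //.
- by rewrite doubleS !addnS.
- by rewrite ltnS leq_eqVlt orbC; case: eqP => [->|/eqP Nck]; rewrite ?eqxx //;
    rewrite eq_sym (negPf Nck) orbF.
- by rewrite I4 I5 I6 !big_ord_recr.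
- move=> j lt_j; rewrite Etab // subset_sumsS I7 //; congr (_ + _).
  by case: ifP => // _; apply: I7; apply: leq_ltn_trans lt_j; apply: leq_subr.
Qed.

(** * The whole program *)

Definition solve : cmd :=
  Read 0 (Cst quota_) ;; Read 0 (Cst actor_) ;; read_matrix ;; read_team ;; setup ;;
  process ;; enum_all.

Lemma sum_gt0 N (F : 'I_N -> nat) : (0 < \sum_v F v) = [exists v, 0 < F v].
Proof.
by rewrite lt0n sum_nat_eq0 negb_forall; apply: eq_existsb => v; rewrite lt0n.
Qed.

Lemma key_bound N (a b e : 'I_N) (y z : bool) :
  a + N * (b + N * (e + N * (y + 2 * z))) < 4 * N ^ 3.
Proof.
have [lt_a lt_b lt_e] := And3 (ltn_ord a) (ltn_ord b) (ltn_ord e).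
have digit i k B : i < N -> k < B -> i + N * k < N * B by nia.
have -> : 4 * N ^ 3 = N * (N * (N * 4)) by rewrite !expnS; lia.
by do 3![apply: (digit) => //]; case: y z => [] [].
Qed.

(** Concerns raw input only: of the star, nothing remains but the criterion that makes [c] the
    vertex found by [read_team]. *)
Lemma eval_solve N q act w c
    (tm := fun u => 0 < nth 0 w (N * N + u))
    (out := fun u => [exists v : 'I_N, 0 < nth 0 w (u * N + v)])
    (inn := fun u => [exists v : 'I_N, 0 < nth 0 w (v * N + u)])
    (num := fun u => nth 0 w (N * N + N + u.*2))
    (den := fun u => nth 0 w (N * N + N + u.*2).+1)
    (easy := fun u => num u <= den u)
    (wt := vertex_weight N c act tm out inn easy) :
  c < N -> ~~ tm c ->
  (forall u, u < N -> nth 0 w (N * N + u) <= 1) ->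
  (forall u, u < N -> ~~ tm u -> out u || ~~ out c -> u = c) ->
  mem (eval N solve (State (fun _ _ => 0) [:: q, act & w])) 0 answer_ =
  \sum_(z : bool) \sum_(y : bool) \sum_(e < N) \sum_(b < N) \sum_(a < N)
    (decide q (ceil_ratio N (num c) (den c))
       (\sum_(u < N) [&& u != c :> nat, tm u, out u & ~~ (inn u && easy u)])
       (\sum_(u < N) [&& u != c :> nat, tm u, out u, inn u & easy u])
       (\sum_(u < N) [&& u != c :> nat, ~~ tm u & easy u]) a b e y == z)
    * ((subset_sums wt N)`_(a + N * (b + N * (e + N * (y + 2 * z)))))%R.
Proof.
move=> lt_c Nc tm01 center_uniq; rewrite /solve 6!eval_seq.
set s1 := eval N (Read 0 (Cst actor_)) _.
have [R0 O0 I0] : [/\ mem s1 0 row_ = 0, forall i, mem s1 Out i = 0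
   & forall i, mem s1 In i = 0] by split=> *; rewrite /s1; lookup.
have w1 : inp s1 = w by rewrite /s1; lookup.
have q1 : mem s1 0 quota_ = q by rewrite /s1; lookup.
have act1 : mem s1 0 actor_ = act by rewrite /s1; lookup.
have Z1 i : i \in [:: found_; n2_; n3_; m_; r_; f_] -> mem s1 0 i = 0.
  by move=> Ii; apply/eqP; move: i Ii; apply/allP; rewrite /= /s1; lookup.
have T1 j : mem s1 Table j = 0 by rewrite /s1; lookup.
clearbody s1.
have [w2 O2 I2] := eval_read_matrix N w1 R0 O0 I0.
set s2 := eval N read_matrix s1 in w2 O2 I2 *.
have f2 : mem s2 0 found_ = 0 by rewrite /s2 eval_frame // Z1.
have [w3 Tm3 C3 C3'] := eval_read_team N w2 f2.
set s3 := eval N read_team s2 in w3 Tm3 C3 C3' *.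
have O3 i : i < N -> (0 < mem s3 Out i) = out i.
  by move=> lt_i; rewrite /s3 eval_frame // O2 // sum_gt0.
have I3 i : i < N -> (0 < mem s3 In i) = inn i.
  by move=> lt_i; rewrite /s3 eval_frame // I2 // sum_gt0.
(* If [c] has a successor, so has the vertex found; if not, any vertex outside the team is [c]. The
   criterion covers both cases. *)
have c3 : mem s3 0 center_ = c.
  have tmc0 : nth 0 w (N * N + c) = 0 by move: Nc; rewrite /tm -eqn0Ngt => /eqP.
  have [lt_c' tmc'] := C3 _ lt_c tmc0.
  apply: center_uniq; rewrite /tm ?tmc' //.
  case: (boolP (out c)) => oc; rewrite ?orbT // orbF -O3 //.
  by rewrite /s3 eval_frame //; apply: C3' tmc0 _ => //; rewrite O2 // sum_gt0.
have [n24 n34 T4] : [/\ mem (eval N setup s3) 0 n2_ = N ^ 2,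
    mem (eval N setup s3) 0 n3_ = N ^ 3
    & forall j, mem (eval N setup s3) Table j = (j == 0)].
  by apply: eval_setup => *; rewrite /s3 eval_frame // /s2 eval_frame // Z1.
set s4 := eval N setup s3 in n24 n34 T4 *.
have w4 : inp s4 = drop (N * N + N) w by rewrite /s4 eval_inp.
have Tm4 u : u < N -> mem s4 Team u = tm u.
  move=> lt_u; rewrite /s4 eval_frame // Tm3 // /tm.
  by move: (tm01 u lt_u); case: (nth _ _ _) => [|[]].
have c4 : mem s4 0 center_ = c by rewrite /s4 eval_frame.
have lt_c4 : mem s4 0 center_ < N by rewrite c4.
have [m4 r4 f4] : [/\ mem s4 0 m_ = 0, mem s4 0 r_ = 0 & mem s4 0 f_ = 0].
  by split; rewrite /s4 eval_frame // /s3 eval_frame // /s2 eval_frame // Z1.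
have act4 : mem s4 0 actor_ = act.
  by rewrite /s4 eval_frame // /s3 eval_frame // /s2 eval_frame.
have q4 : mem s4 0 quota_ = q.
  by rewrite /s4 eval_frame // /s3 eval_frame // /s2 eval_frame.
have O4 i : i < N -> (0 < mem s4 Out i) = out i.
  by move=> lt_i; rewrite /s4 eval_frame // O3.
have I4 i : i < N -> (0 < mem s4 In i) = inn i.
  by move=> lt_i; rewrite /s4 eval_frame // I3.
have := eval_process w4 n24 n34 Tm4 T4 m4 r4 f4 lt_c4.
set s5 := eval N process s4.
have q5 : mem s5 0 quota_ = q by rewrite /s5 eval_frame.
rewrite c4 act4 => -[th5 [m5 r5 f5] T5].
clearbody s5; rewrite eval_enum_all; apply: eq_bigr => z _; apply: eq_bigr => y _.
apply: eq_bigr => e _; apply: eq_bigr => b _; apply: eq_bigr => a _.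
rewrite T5 ?key_bound // /decides q5 th5 m5 r5 f5; congr (_ * _).
  congr (nat_of_bool (decide _ _ _ _ _ _ _ _ _ == _)); apply: eq_bigr => u _;
    by rewrite ?O4 ?I4 // addnA.
congr (nth _ _ _); congr polyseq; apply: eq_bigr => u _.
by rewrite /wt /vertex_weight O4 // I4.
Qed.

(** * Correctness *)

(** Expanding the product selects [1] or ['X^(wt i)] in each factor, and such a selection is a
    vote. *)
Lemma subset_sums_card n (wt : nat -> nat) K : ((subset_sums wt n)`_K)%R =
  \sum_(x : {ffun 'I_n -> bool}) (\sum_u x u * wt u == K) :> nat.
Proof.
have -> : subset_sums wt n = (\sum_(x : {ffun 'I_n -> bool}) 'X^(\sum_u x u * wt u))%R.
  rewrite /subset_sums;
    transitivity (\prod_(u < n) \sum_(b : bool) 'X^(b * wt u) : {poly nat})%R.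
    by apply: eq_bigr => u _; rewrite big_bool mul1n mul0n expr0 addrC.
  by rewrite bigA_distr_bigA; apply: eq_bigr => x _; rewrite expr_sum.
rewrite coef_sum; apply: eq_bigr => x _; rewrite coefXn eq_sym.
by case: eqP.
Qed.

Lemma label_le_nat (r : rat) k : (0 <= r)%R ->
  (r <= k%:R)%R = (`|numq r| <= k * `|denq r|)%N.
Proof.
move=> r_ge0; rewrite -{1}[r]divq_num_den ler_pdivrMr ?ltr0z //.
have nE : ((numq r)%:~R = `|numq r|%N%:R :> rat)%R.
  by rewrite natr_absz ger0_norm // numq_ge0.
have dE : ((denq r)%:~R = `|denq r|%N%:R :> rat)%R by rewrite natr_absz ger0_norm.
by rewrite nE dE -natrM ler_nat.
Qed.

Lemma nth_flatten_const (T : Type) (x0 : T) (ss : seq (seq T)) k i j :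
  all (fun s => size s == k) ss -> i < size ss -> j < k ->
  nth x0 (flatten ss) (i * k + j) = nth x0 (nth [::] ss i) j.
Proof.
elim: ss i => [|s ss IH] [|i] //= /andP[/eqP sk ssk] lt_i lt_j; rewrite nth_cat sk.
  by rewrite lt_j.
by rewrite mulSn -addnA ltnNge leq_addr /= addKn IH.
Qed.

Lemma size_flatten_const (T : Type) (ss : seq (seq T)) k :
  all (fun s => size s == k) ss -> size (flatten ss) = size ss * k.
Proof.
by elim: ss => //= s ss IH /andP[/eqP sk /IH]; rewrite size_cat sk mulSn => ->.
Qed.

Lemma nth_map_ord (T : Type) (x0 : T) n (F : 'I_n -> T) (u : 'I_n) :
  nth x0 [seq F v | v <- enum 'I_n] u = F u.
Proof. by rewrite (nth_map u) ?size_enum_ord // nth_ord_enum. Qed.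

(** * Entries of an encoded instance *)

Section Encoding.
Variables (n : nat) (g : influence_game 'I_n).

Definition graph_code : seq nat :=
  [seq nat_of_bool (edge g u v) | u <- enum 'I_n, v <- enum 'I_n]
  ++ [seq nat_of_bool (u \in team g) | u <- enum 'I_n]
  ++ flatten [seq [:: `|numq (label g u)|%N; `|denq (label g u)|%N] | u <- enum 'I_n].

Let edge_rows : all (fun s => size s == n)
  [seq [seq nat_of_bool (edge g u v) | v <- enum 'I_n] | u <- enum 'I_n].
Proof. by apply/allP => _ /mapP[u _ ->]; rewrite size_map size_enum_ord. Qed.

Lemma nth_code_edge (u v : 'I_n) : nth 0 graph_code (u * n + v) = edge g u v.
Proof.
rewrite /graph_code nth_cat (size_flatten_const edge_rows) size_map size_enum_ord.
have -> : u * n + v < n * n by have := ltn_ord u; have := ltn_ord v; nia.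
rewrite (nth_flatten_const _ edge_rows) ?ltn_ord ?nth_map_ord //.
by rewrite size_map size_enum_ord.
Qed.

Lemma nth_code_team (u : 'I_n) : nth 0 graph_code (n * n + u) = (u \in team g).
Proof.
rewrite /graph_code nth_cat (size_flatten_const edge_rows) size_map size_enum_ord.
rewrite ltnNge leq_addr addKn nth_cat size_map size_enum_ord ltn_ord.
by rewrite nth_map_ord.
Qed.

Lemma nth_code_label (u : 'I_n) :
  nth 0 graph_code (n * n + n + u.*2) = `|numq (label g u)|%N /\
  nth 0 graph_code (n * n + n + u.*2).+1 = `|denq (label g u)|%N.
Proof.
pose ss := [seq [:: `|numq (label g v)|%N; `|denq (label g v)|%N] | v <- enum 'I_n].
have ss2 : all (fun s => size s == 2) ss by apply/allP => _ /mapP[v _ ->].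
have E j : j < 2 -> nth 0 graph_code (n * n + n + (u.*2 + j)) = nth 0 (nth [::] ss u) j.
  move=> lt_j; rewrite /graph_code nth_cat (size_flatten_const edge_rows).
  rewrite size_map size_enum_ord ltnNge -addnA leq_addr addKn nth_cat.
  rewrite size_map size_enum_ord ltnNge leq_addr addKn /= -muln2.
  by rewrite (nth_flatten_const _ ss2) // size_map size_enum_ord.
have := E 0 isT; have := E 1 isT; rewrite nth_map_ord addn0 addn1 !addnS /=.
by [].
Qed.
End Encoding.

(** * Digits of votes and the final count *)

Lemma sum_single (I : finType) (i0 : I) (F : I -> nat) :
  (forall i, i != i0 -> F i = 0) -> \sum_i F i = F i0.
Proof. by move=> F0; rewrite (bigD1 i0) //= big1 ?addn0. Qed.

Lemma digit_inj N i i' k k' : i < N -> i' < N ->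
  i + N * k = i' + N * k' -> i = i' /\ k = k'.
Proof.
move=> lt_i lt_i' E; have N_gt0 : 0 < N by lia.
have := congr1 (modn^~ N) E; have := congr1 (divn^~ N) E.
rewrite ![_ + N * _]addnC ![N * _]mulnC !divnMDl // !modnMDl.
by rewrite !divn_small // !modn_small // !addn0.
Qed.

(** After exchanging the sums, each [x] meets exactly one key, that of its own digits, by uniqueness
    of the expansion. *)
Lemma sum_digits (T : finType) N (D : nat -> nat -> nat -> bool -> bool -> bool)
    (A B E : T -> nat) (Y Z : T -> bool) (W : T -> nat) :
  (forall x, [/\ A x < N, B x < N & E x < N]) ->
  (forall x, W x = A x + N * (B x + N * (E x + N * (Y x + 2 * Z x)))) ->
  \sum_(z : bool) \sum_(y : bool) \sum_(e < N) \sum_(b < N) \sum_(a < N)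
    D a b e y z * \sum_x (W x == a + N * (b + N * (e + N * (y + 2 * z))))
  = \sum_x D (A x) (B x) (E x) (Y x) (Z x).
Proof.
move=> bound WE.
transitivity (\sum_x \sum_(z : bool) \sum_(y : bool) \sum_(e < N) \sum_(b < N) \sum_(a < N)
    D a b e y z * (W x == a + N * (b + N * (e + N * (y + 2 * z))))).
  rewrite [RHS]exchange_big; apply: eq_bigr => z _.
  rewrite [RHS]exchange_big; apply: eq_bigr => y _.
  rewrite [RHS]exchange_big; apply: eq_bigr => e _.
  rewrite [RHS]exchange_big; apply: eq_bigr => b _.
  rewrite [RHS]exchange_big; apply: eq_bigr => a _.
  by rewrite big_distrr.
apply: eq_bigr => x _; have [lt_A lt_B lt_E] := bound x.
have key (a b e : 'I_N) (y z : bool) :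
    W x == a + N * (b + N * (e + N * (y + 2 * z))) ->
    [/\ a = Ordinal lt_A, b = Ordinal lt_B, e = Ordinal lt_E, y = Y x & z = Z x].
  rewrite WE => /eqP /(digit_inj lt_A (ltn_ord a))[Ea].
  move=> /(digit_inj lt_B (ltn_ord b))[Eb] /(digit_inj lt_E (ltn_ord e))[Ee] Eyz.
  split; try exact: val_inj; by move: Eyz; case: y z (Y x) (Z x) => [] [] [] [].
have zero (a b e : 'I_N) (y z : bool) :
    ~ [/\ a = Ordinal lt_A, b = Ordinal lt_B, e = Ordinal lt_E, y = Y x & z = Z x] ->
    D a b e y z * (W x == a + N * (b + N * (e + N * (y + 2 * z)))) = 0.
  by move=> Nkey; case: eqP => [/eqP/key//|_]; rewrite muln0.
rewrite (sum_single (i0 := Z x)) => [|z /eqP Nz]; last first.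
  by do 4![apply: big1 => ? _]; apply: zero => -[].
rewrite (sum_single (i0 := Y x)) => [|y /eqP Ny]; last first.
  by do 3![apply: big1 => ? _]; apply: zero => -[].
rewrite (sum_single (i0 := Ordinal lt_E)) => [|e /eqP Ne]; last first.
  by do 2![apply: big1 => ? _]; apply: zero => -[].
rewrite (sum_single (i0 := Ordinal lt_B)) => [|b /eqP Nb]; last first.
  by apply: big1 => ? _; apply: zero => -[].
rewrite (sum_single (i0 := Ordinal lt_A)) => [|a /eqP Na]; last by apply: zero => -[].
by rewrite /= -WE eqxx muln1.
Qed.

Lemma eval_solve_Sat n (g : influence_game 'I_n) (i : 'I_n)
    (L I R : {set 'I_n}) (c : 'I_n) (F : {set 'I_n}) :
  star_graph g L I R c F -> team g = L :|: R :|: I -> positive_labels g ->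
  mem (eval n solve (State (fun _ _ => 0) [:: quota g, i : nat & graph_code g])) 0 22
  = Sat g i.
Proof.
move=> star teamE label_gt0; set w := graph_code g.
pose out (u : 'I_n) := [exists v, edge g u v].
pose inn (u : 'I_n) := [exists v, edge g v u].
pose easy (u : 'I_n) := (label g u <= 1)%R.
have tmE (u : 'I_n) : (0 < nth 0 w (n * n + u)) = (u \in team g).
  by rewrite nth_code_team lt0b.
have outE (u : 'I_n) : [exists v : 'I_n, 0 < nth 0 w (u * n + v)] = out u.
  by apply: eq_existsb => v; rewrite nth_code_edge lt0b.
have innE (u : 'I_n) : [exists v : 'I_n, 0 < nth 0 w (v * n + u)] = inn u.
  by apply: eq_existsb => v; rewrite nth_code_edge lt0b.
have labelE k (u : 'I_n) : (nth 0 w (n * n + n + u.*2) <=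
    k * nth 0 w (n * n + n + u.*2).+1) = (label g u <= k%:R)%R.
  by have [-> ->] := nth_code_label g u; rewrite label_le_nat ?label_ge0.
have easyE (u : 'I_n) :
    (nth 0 w (n * n + n + u.*2) <= nth 0 w (n * n + n + u.*2).+1) = easy u.
  by rewrite -[X in _ <= X]mul1n labelE.
rewrite (@eval_solve n (quota g) i w c) //; last first.
- move=> u lt_u; rewrite (tmE (Ordinal lt_u)) (outE (Ordinal lt_u)) outE.
  by move=> Tu outs; have /(congr1 val) := center_unique star teamE Tu outs.
- by move=> u lt_u; rewrite (nth_code_team g (Ordinal lt_u)) leq_b1.
- by rewrite tmE; apply: center_team star teamE.
set th := ceil_ratio _ _ _.
have thP k : k < #|'I_n| -> (label g c <= k%:R)%R = (th <= k).
  by rewrite card_ord => lt_k; rewrite -ceil_ratioP // labelE.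
have cardE (P : pred 'I_n) (Q : 'I_n -> bool) : P =1 Q -> \sum_u Q u = #|P|.
  move=> PQ; rewrite -sum1_card [RHS]big_mkcond; apply: eq_bigr => u _.
  by rewrite -PQ unfold_in; case: (P u).
rewrite (cardE (firm_pred g L R)); last first.
  by move=> u; rewrite tmE outE innE easyE (firm_predE star teamE).
rewrite (cardE (soft_pred g R)); last first.
  by move=> u; rewrite tmE outE innE easyE (soft_predE star teamE).
rewrite (cardE (soft_leaf g F)); last first.
  by move=> u; rewrite tmE easyE (soft_leafE star teamE).
set wt := vertex_weight _ _ _ _ _ _ _.
pose cls (u : 'I_n) :=
  class_weight n (n ^ 2) (n ^ 3) (u == c) (u \in team g) (out u) (inn u) (easy u).
have wtE (u : 'I_n) : wt u = cls u + (u == i) * (2 * n ^ 3).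
  by rewrite /wt /vertex_weight tmE outE innE easyE.
have clsA u : firm_pred g L R u -> cls u = 1.
  rewrite (firm_predE star teamE) -/(out u) -/(inn u) -/(easy u) /cls /class_weight.
  by case/and4P=> /negPf-> -> -> /negPf->.
have clsB u : soft_pred g R u -> cls u = n.
  rewrite (soft_predE star teamE) -/(out u) -/(inn u) -/(easy u) /cls.
  by move=> /and5P[/negPf-> -> -> -> ->].
have clsE u : independent g I F u -> cls u = n ^ 2.
  rewrite (independentE star teamE) -/(out u) -/(easy u) /cls => /andP[/negPf->].
  by case: ifP => _ /negPf->.
have clsD u : soft_leaf g F u -> cls u = 0.
  by rewrite (soft_leafE star teamE) -/(easy u) /cls => /and3P[/negPf-> /negPf-> ->].
have clsc : cls c = n ^ 3 by rewrite /cls eqxx.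
pose a (x : {ffun 'I_n -> bool}) := chosen (firm_pred g L R) x.
pose b (x : {ffun 'I_n -> bool}) := chosen (soft_pred g R) x.
pose e (x : {ffun 'I_n -> bool}) := chosen (independent g I F) x.
pose W (x : {ffun 'I_n -> bool}) := \sum_u x u * wt u.
(* The share of the actor is split off first; grouping the rest by class yields the digits. *)
have WE x : W x = a x + n * (b x + n * (e x + n * (x c + 2 * x i))).
  transitivity (\sum_u x u * cls u + x i * (2 * n ^ 3)).
    have -> : x i * (2 * n ^ 3) = \sum_u x u * ((u == i) * (2 * n ^ 3)).
      rewrite (sum_single (i0 := i)) ?eqxx ?mul1n // => u /negPf->.
      by rewrite mul0n muln0.
    by rewrite -big_split; apply: eq_bigr => u _; rewrite wtE mulnDr.
  rewrite (star_sum star).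
  rewrite (eq_bigr (fun u => x u : nat)) => [|u /clsA->]; last by rewrite muln1.
  rewrite [\sum_(u | soft_pred g R u) _](eq_bigr (fun u => x u * n)) => [|u /clsB->//].
  rewrite [\sum_(u | independent g I F u) _](eq_bigr (fun u => x u * n ^ 2));
    last by move=> u /clsE->.
  rewrite [\sum_(u | soft_leaf g F u) _]big1 => [|u /clsD->]; last by rewrite muln0.
  rewrite -!big_distrl clsc -/(chosen _ _) -/(a x).
  rewrite -[\sum_(u | soft_pred g R u) _]/(b x).
  by rewrite -[\sum_(u | independent g I F u) _]/(e x) /= !expnS; lia.
have bound x : [/\ a x < n, b x < n & e x < n].
  have [cL cI cR cF] := center_class star.
  by split; rewrite -[n in _ < n]card_ord; apply: (@chosen_ltn _ c);
    rewrite /firm_pred /soft_pred /independent ?negb_or ?negb_and ?cL ?cI ?cR ?cF.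
transitivity (\sum_x (decide (quota g) th #|firm_pred g L R| #|soft_pred g R| #|soft_leaf g F|
    (a x) (b x) (e x) (x c) == x i) : nat); last first.
  rewrite /Sat -[RHS]sum1_card [RHS]big_mkcond; apply: eq_bigr => x _.
  by rewrite inE (collective_star star teamE label_gt0 x thP); case: (_ == _).
rewrite -(sum_digits (fun a b e y z => decide (quota g) th #|firm_pred g L R| #|soft_pred g R|
  #|soft_leaf g F| a b e y == z) bound WE).
apply: eq_bigr => z _; apply: eq_bigr => y _; apply: eq_bigr => e' _.
apply: eq_bigr => b' _; apply: eq_bigr => a' _.
by rewrite subset_sums_card.
Qed.

Theorem theorem6 : polytime_solvable star_instance encode_instance Sat_of.
Proof.
apply: (@compile_polytime _ _ _ _ solve (Get 0 (Cst 22))) => -[n g i].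
move=> [[L [I [R [c [F [star teamE]]]]]] label_gt0].
exists n, [:: quota g, i : nat & graph_code g]; split=> //.
  (* The actor makes [n] positive, and the characteristic vector of the team alone has length
     [n]. *)
  rewrite (leq_ltn_trans _ (ltn_ord i)) //= /graph_code !size_cat.
  by rewrite [X in _ + (X + _)]size_map size_enum_ord; lia.
exact: eval_solve_Sat star teamE label_gt0.
Qed.
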